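(* Let $n\geqslant k\geqslant 2$ and let $S=(v_1,\ldots,v_n)$ be an $(n,k)$-uframe at which the function $F(S')=\vol\left(\mathop{\rm co}\{\pm v'_1,\ldots,\pm v'_n\}\right)$, $S'=(v'_1,\dots,v'_n)\in\Omega(n,k)$, attains a local maximum on $\Omega(n,k)$. Let $P=\mathop{\rm co}\{\pm v_1,\ldots,\pm v_n\}$. Then $P$ is a simplicial polytope, and for every vertex $v$ of $P$, $$|v|^2=\frac{\vol N_P(v)}{\vol P}.$$
   Context: An $(n,k)$-frame is an ordered $n$-tuple of vectors in $\mathbb{R}^k$ spanning $\mathbb{R}^k$ (repetitions and zero vectors allowed). It is an $(n,k)$-uframe if $\sum_{i=1}^n v_i\otimes v_i=I_k$ (i.e. $\sum v_iv_i^T$ is the identity). $\Omega(n,k)$ is the set of all $(n,k)$-uframes, viewed as a subset of $\mathbb{R}^{k\times n}$ with the Euclidean topology; local maximum is with respect to this topology. $\vol$ is $k$-dimensional volume and $|\cdot|$ the Euclidean norm. For a centrally symmetric polytope $P\subset\mathbb{R}^k$ and a vertex $v$ of $P$, the star of $v$ is $N_P(v)=\bigcup \mathop{\rm co}(F\cup\{0\})$, the union over all facets $F$ of $P$ containing $v$ or containing $-v$. *)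

(* Defs.v *)
From HB Require Import structures.
From mathcomp Require Import all_boot all_order all_algebra.
From mathcomp Require Import all_classical all_reals all_analysis.
Set Implicit Arguments. Unset Strict Implicit. Unset Printing Implicit Defensive.
Import Order.TTheory GRing.Theory Num.Theory.
Local Open Scope classical_set_scope.
Local Open Scope ring_scope.

Section Defs.
Variable R : realType.

Definition dotv k (a x : 'cV[R]_k) : R := (a^T *m x) 0 0.
Definition sqnorm k (x : 'cV[R]_k) : R := dotv x x.

Definition conv k (A : set 'cV[R]_k) : set 'cV[R]_k :=
  [set x | exists (m : nat) (w : 'I_m -> R) (p : 'I_m -> 'cV[R]_k),
     (forall i, A (p i)) /\ (forall i, 0 <= w i) /\ \sum_i w i = 1 /\
     x = \sum_i w i *: p i].

Definition aff_indep k m (w : 'I_m -> 'cV[R]_k) : Prop :=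
  forall c : 'I_m -> R, \sum_i c i = 0 -> \sum_i c i *: w i = 0 ->
    forall i, c i = 0.

(* facet of a (full-dimensional) polytope P in R^k: the intersection of P
   with a supporting hyperplane, having affine dimension k-1 *)
Definition facet k (P F : set 'cV[R]_k) : Prop :=
  exists (a : 'cV[R]_k) (b : R), a != 0 /\
    (forall x, P x -> dotv a x <= b) /\
    F = P `&` [set x | dotv a x = b] /\
    exists w : 'I_k -> 'cV[R]_k, (forall i, F (w i)) /\ aff_indep w.

Definition vertex k (P : set 'cV[R]_k) (v : 'cV[R]_k) : Prop :=
  P v /\ exists a : 'cV[R]_k, forall x, P x -> x <> v -> dotv a x < dotv a v.

Definition simplicial k (P : set 'cV[R]_k) : Prop :=
  forall F, facet P F ->
    exists w : 'I_k -> 'cV[R]_k, aff_indep w /\ F = conv (range w).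

Definition star k (P : set 'cV[R]_k) (v : 'cV[R]_k) : set 'cV[R]_k :=
  [set x | exists F, facet P F /\ (F v \/ F (- v)) /\ conv (F `|` [set 0]) x].

(* k-dimensional Lebesgue volume, as the iterated Lebesgue integral of the
   indicator function (sets of real sequences, coordinates peeled off one
   at a time) *)
Fixpoint voln (k : nat) (A : set (seq R)) : \bar R :=
  match k with
  | 0 => ((\1_A : seq R -> R) [::])%:E
  | k'.+1 => (\int[@lebesgue_measure R]_x voln k' [set s | A (x :: s)])%E
  end.

Definition vol k (A : set 'cV[R]_k) : \bar R :=
  voln k [set s | exists x, A x /\ s = [seq x i 0 | i <- enum 'I_k]].

(* (n,k)-frames / uframes: the columns of S : 'M_(k,n) are v_1..v_n *)
Definition frame k n (S : 'M[R]_(k, n)) : Prop := \rank S = k.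
Definition uframe k n (S : 'M[R]_(k, n)) : Prop :=
  frame S /\ S *m S^T = 1%:M.

Definition symhull k n (S : 'M[R]_(k, n)) : set 'cV[R]_k :=
  conv [set x | exists i, x = col i S \/ x = - col i S].

Definition Fvol k n (S : 'M[R]_(k, n)) : \bar R := vol (symhull S).

Definition mxdist2 k n (S T : 'M[R]_(k, n)) : R :=
  \sum_i \sum_j (S i j - T i j) ^+ 2.

Definition local_max_on_Omega k n (S : 'M[R]_(k, n)) : Prop :=
  uframe S /\ exists eps : R, 0 < eps /\
    forall T : 'M[R]_(k, n), uframe T -> mxdist2 S T < eps ^+ 2 ->
      (Fvol T <= Fvol S)%E.

End Defs.

(* Main.v *)
Require Import Defs.
From HB Require Import structures.
From mathcomp Require Import all_boot all_order all_algebra.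
From mathcomp Require Import all_classical all_reals all_analysis.
From mathcomp Require Import measurable_realfun ring lra.
Import Order.TTheory GRing.Theory Num.Theory.
Local Open Scope classical_set_scope.
Local Open Scope ring_scope.

(** Write P for the hull of the columns p_j of [row_mx S (- S)], encode a facet
    by the set J of the j with p_j on it, and let C_J be the pyramid over
    it with apex 0. Replacing v_i by (1+t) v_i adds to P, over every facet
    containing v_i or -v_i, a pyramid of volume t vol C_J, and multiplies
    det (S S^T) by 1 + (2t+t^2) |v_i|^2. Renormalising by the inverse square root
    of the Gram matrix gives a uframe close to S, so local maximality yields, as
    t tends to 0,
      sum of vol C_J over the facets containing v_i or -v_i <= |v_i|^2 vol P.
    Summing over i, the right-hand side becomes k vol P because the |v_i|^2 add
    up to the trace of S S^T, while the left-hand side is the sum over all facets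
    of |J| vol C_J, at least k times the sum of the vol C_J, which is at least
    k vol P since the C_J cover P up to a null set. Hence all these inequalities
    are equalities: every facet contains exactly k of the p_j, and the bounds on
    the stars are attained. *)

Set Implicit Arguments.
Unset Strict Implicit.
Unset Printing Implicit Defensive.

(** * Lebesgue measure on column vectors *)

(** Only [t > 0] is used. Whatever its facets are, the enlarged polytope contains P and the pushed
    out pyramids, so a lower bound for its volume is enough; for negative [t] the new facets would
    have to be known. The opposite inequality is supplied by the summation over [i]. Likewise the
    C_J are never shown to be disjoint: they only have to cover P, and the chain of inequalities
    does the rest.

    Facets are sets of indices rather than of points, so that repeated vectors are counted with
    multiplicity in |J|; a zero column lies on no facet.

    Convexity is handled by pivots of the simplex method instead of topology and separation. They
    present a hull as a finite union of simplices, hence as a measurable set, and they produce the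
    facet over a generic point as the optimum of a linear program. *)

Section ProdSigmaFinite.
Context d1 d2 (T1 : measurableType d1) (T2 : measurableType d2) (R : realType).
Variable m1 : {sigma_finite_measure set T1 -> \bar R}.
Variable m2 : {sigma_finite_measure set T2 -> \bar R}.

(* An alias of [m1 \x m2]: on the product itself the library's instances for
   subprobabilities shadow the sigma-finite one. *)
Definition prod_meas : set (T1 * T2)%type -> \bar R := (m1 \x m2)%E.

HB.instance Definition _ := Measure.copy prod_meas (m1 \x m2)%E.
Let prod_meas_sigma_finite : sigma_finite setT prod_meas.
Proof.
exact: (isSigmaFinite.sigma_finiteT
  (lebesgue_integral_fubini.measure_function_Measure_isSigmaFinite__to__measure_function_isSigmaFinite m1 m2)).
Qed.

HB.instance Definition _ :=
  Measure_isSigmaFinite.Build _ _ _ prod_meas prod_meas_sigma_finite.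

End ProdSigmaFinite.

Section IteratedMeasure.
Variable R : realType.

Definition cons_cv k (a : R) (x : 'cV[R]_k) : 'cV[R]_k.+1 :=
  col_mx (a%:M : 'M[R]_1) x.

Lemma cons_cv0 k a (x : 'cV[R]_k) j : cons_cv a x 0 j = a.
Proof.
have := col_mxEu (a%:M : 'M[R]_1) x 0 j; rewrite lshift0 -/(cons_cv a x) => ->.
by rewrite mxE (ord1 j) mulr1n.
Qed.

Lemma cons_cvS k a (x : 'cV[R]_k) i j : cons_cv a x (lift 0 i) j = x i j.
Proof. by rewrite -rshift1; apply: col_mxEd. Qed.

Definition behead_cv k (x : 'cV[R]_k.+1) : 'cV[R]_k := \col_i x (lift 0 i) 0.

Lemma cons_behead_cv k (x : 'cV[R]_k.+1) : cons_cv (x 0 0) (behead_cv x) = x.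
Proof.
apply/matrixP => i j; rewrite (ord1 j); case: (unliftP 0 i) => [i'|] ->.
  by rewrite cons_cvS mxE.
by rewrite cons_cv0.
Qed.

Lemma behead_cons_cv k a (x : 'cV[R]_k) : behead_cv (cons_cv a x) = x.
Proof. by apply/matrixP => i j; rewrite mxE cons_cvS ord1. Qed.

Notation leb := (@lebesgue_measure R).

(** The type and its measure come from one recursion on the dimension, hence the bundle;
    sigma-finiteness is carried along for the product measure of the next dimension. *)
Record sfspace := SFSpace {
  sfdisp : measure_display;
  sftype : measurableType sfdisp;
  sfmeas : {sigma_finite_measure set sftype -> \bar R} }.

Fixpoint euclid (k : nat) : sfspace :=
  match k with
  | 0 => @SFSpace _ unit (@dirac _ unit tt R)
  | k'.+1 => @SFSpace _ (measurableTypeR R * sftype (euclid k'))%type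
               (prod_meas leb (sfmeas (euclid k')))
  end.

Notation T k := (sftype (euclid k)).
Notation mu k := (sfmeas (euclid k)).

Fixpoint cv_of (k : nat) : T k -> 'cV[R]_k :=
  match k with
  | 0 => fun=> 0
  | k'.+1 => fun t => cons_cv t.1 (cv_of t.2)
  end.

Fixpoint of_cv (k : nat) : 'cV[R]_k -> T k :=
  match k with
  | 0 => fun=> tt
  | k'.+1 => fun x => (x 0 0, of_cv (behead_cv x))
  end.

Lemma of_cvK k : cancel (@of_cv k) (@cv_of k).
Proof.
elim: k => [x|k IH x] /=; first by apply/matrixP=> -[].
by rewrite IH cons_behead_cv.
Qed.

Definition seq_of k (x : 'cV[R]_k) : seq R := [seq x i 0 | i <- enum 'I_k].

Lemma seq_of_cons k (a : R) (x : 'cV[R]_k) :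
  seq_of (cons_cv a x) = a :: seq_of x.
Proof.
rewrite /seq_of (@enum_ordSl k) /= cons_cv0 -map_comp; congr cons.
by apply/eq_map => i /=; rewrite cons_cvS.
Qed.

Lemma seq_of_inj k : injective (@seq_of k).
Proof.
move=> x y /eq_in_map H; apply/matrixP => i j; rewrite ord1.
by apply: H; rewrite mem_enum.
Qed.

(** Peeling off a coordinate in [voln] is the definition of [product_measure1] by sections, so the
    induction only rewrites under the integral. *)
Lemma voln_mu k (A : set (seq R)) :
  voln k A = mu k [set t | A (seq_of (cv_of t))].
Proof.
elim: k A => [|k IH] A /=.
  rewrite /dirac /=; congr (_%:E); rewrite !indicE; congr (_%:R).
  congr (nat_of_bool _); apply/idP/idP; rewrite !inE /= /seq_of enum_ord0 //=.
rewrite /prod_meas /product_measure1; apply: eq_integral => x _ /=.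
rewrite IH; congr (mu k _); apply/seteqP; split => t /=;
  by rewrite /xsection /= inE /= seq_of_cons.
Qed.

Definition pre k (A : set 'cV[R]_k) : set (T k) := @cv_of k @^-1` A.
Definition mble k (A : set 'cV[R]_k) := measurable (pre A).

Lemma volE k (A : set 'cV[R]_k) : vol A = mu k (pre A).
Proof.
rewrite /vol voln_mu; congr (mu k _); apply/seteqP; split => t /=.
  by move=> [x [Ax /seq_of_inj]]; rewrite /pre /= => ->.
by move=> At; exists (cv_of t).
Qed.


Lemma volS k (A : set 'cV[R]_k.+1) :
  vol A = (\int[leb]_x vol [set y | A (cons_cv x y)])%E.
Proof.
rewrite volE /= /prod_meas /product_measure1.
apply: eq_integral => x _ /=; rewrite volE; congr (mu k _).
by apply/seteqP; split => t; rewrite /xsection /= inE.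
Qed.

Lemma mble_slice k (A : set 'cV[R]_k.+1) x :
  mble A -> mble [set y | A (cons_cv x y)].
Proof.
move=> mA; have := @measurable_xsection _ _ _ _ _ x mA.
congr measurable; apply/seteqP; split => t; rewrite /xsection /= inE //.
Qed.

Lemma measurable_vol_slice k (A : set 'cV[R]_k.+1) : mble A ->
  measurable_fun setT
    ((fun x => vol [set y | A (cons_cv x y)]) : measurableTypeR R -> \bar R).
Proof.
move=> mA.
have := @measurable_fun_xsection _ _ _ _ _ (mu k) _ mA.
apply: eq_measurable_fun => x _ /=; rewrite volE; congr (mu k _).
by apply/seteqP; split => t; rewrite /xsection /= inE.
Qed.

Lemma vol_ge0 k (A : set 'cV[R]_k) : (0 <= vol A)%E.
Proof. by rewrite volE. Qed.

Lemma measurable_cv_of k i :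
  measurable_fun setT (fun t : T k => cv_of t i 0 : R).
Proof.
elim: k i => [[]//|k IH] i /=.
case: (unliftP 0 i) => [i'|] ->.
  under [X in measurable_fun _ X]eq_fun do rewrite cons_cvS.
  exact: (measurableT_comp (IH i') measurable_snd).
under [X in measurable_fun _ X]eq_fun do rewrite cons_cv0.
exact: measurable_fst.
Qed.

Lemma measurable_of_cv d (X : measurableType d) k (h : X -> 'cV[R]_k) :
  (forall i, measurable_fun setT (fun x => h x i 0 : R)) ->
  measurable_fun setT (fun x => of_cv (h x)).
Proof.
elim: k h => [|k IH] h mh /=; first exact: measurable_cst.
apply: measurable_fun_pair; first exact: mh.
apply: IH => i; under [X in measurable_fun _ X]eq_fun do rewrite mxE.
exact: mh.
Qed.

Lemma mble_preimage k l (h : 'cV[R]_k -> 'cV[R]_l) (A : set 'cV[R]_l) :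
  (forall i, measurable_fun setT (fun t : T k => h (cv_of t) i 0 : R)) ->
  mble A -> mble (h @^-1` A).
Proof.
move=> /measurable_of_cv mh mA.
have := mh measurableT _ mA; rewrite setTI; congr measurable.
by apply/seteqP; split => t; rewrite /pre /= of_cvK.
Qed.

Lemma measurable_affine k l (B : 'M[R]_(l, k)) (c : 'cV[R]_l) i :
  measurable_fun setT
    (fun t : T k => (B *m cv_of t + c) i 0 : R).
Proof.
under [X in measurable_fun _ X]eq_fun do rewrite !mxE.
apply: measurable_funD; last exact: measurable_cst.
apply: measurable_sum => j; apply: measurable_funM; first exact: measurable_cst.
exact: measurable_cv_of.
Qed.

Lemma mble_affine k l (B : 'M[R]_(l, k)) (c : 'cV[R]_l) (A : set 'cV[R]_l) :
  mble A -> mble [set x | A (B *m x + c)].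
Proof. exact/mble_preimage/measurable_affine. Qed.

Lemma mble_halfspace k (a : 'cV[R]_k) (b : R) : mble [set x | dotv a x <= b].
Proof.
rewrite /mble; have := @measurable_affine _ _ a^T 0 0 measurableT _ (measurable_itv `]-oo, b]).
rewrite setTI; congr measurable; apply/seteqP; split => t;
  by rewrite /pre /= in_itv /= addr0.
Qed.

End IteratedMeasure.

(** * Affine change of variables *)

Section ChangeOfVariables.
Variable R : realType.
Notation leb := (@lebesgue_measure R).
Notation T k := (sftype (euclid R k)).
Notation mu k := (sfmeas (euclid R k)).

Lemma measurable_affine1 (a c : R) :
  measurable_fun setT (fun x : measurableTypeR R => a * x + c : measurableTypeR R).
Proof.
apply: measurable_funD; last exact: measurable_cst.
by apply: measurable_funM; [exact: measurable_cst|exact: measurable_id].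
Qed.

(** Both sides are measures in [A], so it suffices to compare them on the intervals []u, v]]; a
    negative [a] turns these into intervals open on the other side. *)
Lemma lebesgue_measure_affine (a c : R) (A : set (measurableTypeR R)) : a != 0 ->
  measurable A -> (`|a|%R%:E * leb ((fun x => (a * x + c)%R) @^-1` A))%E = leb A.
Proof.
move=> a0; have aa : 0 <= `|a| by [].
pose p : {measure set (measurableTypeR R) -> \bar R} :=
  measure_function_pushforward__canonical__measure_function_Measure leb
    (measurable_affine1 a c).
pose nu : {measure set (measurableTypeR R) -> \bar R} := mscale (NngNum aa) p.
move: A; suff H : forall A : set (measurableTypeR R), measurable A -> leb A = nu A.
  by move=> A mA; rewrite [RHS](H A mA).
apply: lebesgue_measure_unique => _ [[u v] _ <-] /=.
rewrite /nu /p /= /mscale /= /pushforward /=.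
have [ap|an|/eqP] := ltrgt0P a; last by rewrite (negbTE a0).
  have -> : (fun x => a * x + c) @^-1` `]u, v]%classic = `](u - c) / a, (v - c) / a]%classic.
    apply/seteqP; split => x; rewrite /= !in_itv /= ler_pdivlMr // ltr_pdivrMr //;
    by rewrite ltrBlDr lerBrDr (mulrC x).
  rewrite !lebesgue_measure_itv /= !lte_fin ltr_pM2r ?invr_gt0 // ltrD2r.
  case: ifP => _; last by rewrite mule0.
  by rewrite -!EFinB -EFinM; congr _%:E; field.
have -> : (fun x => a * x + c) @^-1` `]u, v]%classic = `[(v - c) / a, (u - c) / a[%classic.
  apply/seteqP; split => x; rewrite /= !in_itv /= ler_ndivrMr // ltr_ndivlMr //;
  by rewrite ltrBlDr lerBrDr (mulrC x) andbC.
rewrite !lebesgue_measure_itv /= !lte_fin ltr_nM2r ?invr_lt0 // ltrD2r.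
case: ifP => _; last by rewrite mule0.
by rewrite -!EFinB -EFinM; congr _%:E; field.
Qed.

Lemma ge0_integral_affine (a c : R) (f : R -> \bar R) : a != 0 ->
  measurable_fun setT (f : measurableTypeR R -> \bar R) ->
  (forall x, 0 <= f x)%E ->
  (`|a|%R%:E * \int[leb]_x f (a * x + c)%R)%E = (\int[leb]_x f x)%E.
Proof.
move=> a0 mf f0; have aa : 0 <= `|a| by [].
pose h (x : measurableTypeR R) : measurableTypeR R := a * x + c.
have mh : measurable_fun setT h by exact: measurable_affine1.
pose p : {measure set (measurableTypeR R) -> \bar R} :=
  measure_function_pushforward__canonical__measure_function_Measure leb mh.
transitivity (\int[mscale (NngNum aa) p]_x f x)%E.
  rewrite ge0_integral_mscale //; congr (_ * _)%E.
  by rewrite (ge0_integral_pushforward mh leb measurableT).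
apply: eq_measure_integral => A mA _.
exact: (lebesgue_measure_affine c a0 mA).
Qed.

(* Invertible matrices are products of block lower triangular matrices, treated
   slice by slice, and of shears of the first coordinate, treated by Tonelli. *)
Definition scales k (B : 'M[R]_k) := forall (c : 'cV[R]_k) (A : set 'cV[R]_k),
  mble A -> (`|\det B|%:E * vol [set x | A (B *m x + c)%R])%E = vol A.

Lemma scales_mul k (B C : 'M[R]_k) :
  scales B -> scales C -> scales (B *m C).
Proof.
move=> sB sC c A mA; rewrite det_mulmx normrM EFinM -muleA -(sB c A mA).
rewrite -(sC 0 [set x | A (B *m x + c)]); last exact: mble_affine.
by congr (_ * (_ * vol _))%E; apply/seteqP; split => x /=; rewrite addr0 mulmxA.
Qed.

Lemma block_mul_cons k (a : R) (r : 'rV[R]_k) (u : 'cV[R]_k) (D : 'M[R]_k) x0 x :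
  (block_mx a%:M r u D : 'M[R]_(1 + k)) *m cons_cv x0 x =
  cons_cv (a * x0 + (r *m x) 0 0) (x0 *: u + D *m x).
Proof.
rewrite /cons_cv [LHS]mul_block_col !mul_mx_scalar; congr col_mx.
by apply/matrixP => i j; rewrite !ord1 !mxE eqxx !mulr1n mulrC.
Qed.

Lemma cons_cvD k a b (x y : 'cV[R]_k) :
  cons_cv a x + cons_cv b y = cons_cv (a + b) (x + y).
Proof.
apply/matrixP => i j; rewrite mxE.
by case: (unliftP 0 i) => [i'|] ->; rewrite ?cons_cvS ?cons_cv0 ?mxE.
Qed.

Lemma block_affine_cons k (a : R) (r : 'rV[R]_k) (u : 'cV[R]_k) (D : 'M[R]_k)
    (c : 'cV[R]_k.+1) x0 x :
  (block_mx a%:M r u D : 'M[R]_(1 + k)) *m cons_cv x0 x + c =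
  cons_cv (a * x0 + (r *m x) 0 0 + c 0 0) (D *m x + (x0 *: u + behead_cv c)).
Proof.
by rewrite block_mul_cons -{1}(cons_behead_cv c) cons_cvD addrA [D *m x + _]addrC.
Qed.

(** The slice at [x] goes to the slice at [a * x + c 0 0] by [D] followed by a translation that
    depends on [x]; this is why [scales] quantifies over translations. *)
Lemma scales_lblock k (a : R) (u : 'cV[R]_k) (D : 'M[R]_k) : a != 0 ->
  scales D -> scales (block_mx a%:M 0 u D : 'M[R]_(1 + k)).
Proof.
move=> a0 sD c A mA.
rewrite det_lblock det_scalar1 normrM EFinM [X in (_ * X)%E]volS -muleA.
rewrite -ge0_integralZl //; first last.
- by move=> x _; exact: vol_ge0.
- by apply: measurable_vol_slice; exact: mble_affine.
under eq_integral => x _.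
  have -> : (`|\det D|%:E * vol [set y | [set x1 | A
      ((block_mx a%:M 0 u D : 'M[R]_(1 + k)) *m x1 + c)%R] (cons_cv x y)])%E =
    vol [set y | A (cons_cv (a * x + c 0 0)%R y)].
    rewrite -(sD (x *: u + behead_cv c) [set y | A (cons_cv (a * x + c 0 0) y)]).
      congr (_ * vol _)%E; apply/seteqP; split => y /=;
      by rewrite block_affine_cons mul0mx mxE addr0.
    exact: mble_slice.
  over.
rewrite [RHS]volS.
rewrite (ge0_integral_affine (c 0 0) a0 (f := fun z => vol [set y | A (cons_cv z y)])) //.
  exact: measurable_vol_slice.
by move=> x; exact: vol_ge0.
Qed.

Lemma scales1 k : scales (1%:M : 'M[R]_k).
Proof.
elim: k => [|k IH].
  move=> c A mA; rewrite det1 normr1 mul1e; congr vol.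
  by apply/seteqP; split => x /=; rewrite [_ + _](_ : _ = x) //; apply/matrixP => -[].
rewrite -[X in scales X]/(1%:M : 'M[R]_(1 + k)) scalar_mx_block.
by apply: scales_lblock => //; rewrite oner_neq0.
Qed.

Lemma scales_shear k (r : 'rV[R]_k) : scales (block_mx 1%:M r 0 1%:M : 'M[R]_(1 + k)).
Proof.
(* The translation by [c] is absorbed into [A'], which has the volume of [A] by [scales1], so that
   only the linear shear remains. *)
move=> c A mA; rewrite -[RHS](scales1 c mA) !det1 [\det _]det_ublock !det1.
rewrite mulr1 normr1 !mul1e; set E := block_mx _ _ _ _.
pose A' := [set x | A (1%:M *m x + c)].
have mA' : mble A' by exact: mble_affine.
have -> : [set x | A (E *m x + c)] = [set x | A' (E *m x + 0)].
  by apply/seteqP; split => x; rewrite /A' /= mul1mx addr0.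
have mEA : mble [set x | A' (E *m x + 0)] by exact: mble_affine.
rewrite -[X in _ = vol X]/A' !volE /= /prod_meas.
(* With the order of integration exchanged, sections fix all coordinates but the first, and on each
   of them the shear is a translation. *)
pose m2 : {measure set (measurableTypeR R * T k)%type -> \bar R} :=
  (leb \x^ mu k)%E.
have E2 X : measurable X -> (leb \x mu k)%E X = m2 X.
  apply: product_measure_unique => A1 A2 mA1 mA2; exact: product_measure2E.
rewrite (E2 _ mEA) (E2 _ mA').
apply: eq_integral => t _ /=.
have := @lebesgue_measure_affine 1 ((r *m cv_of t) 0 0) _ (oner_neq0 _)
  (@measurable_ysection _ _ _ _ _ t mA').
rewrite normr1 mul1e => <-; congr (leb _); apply/seteqP; split => x;
rewrite /ysection /= !inE /= /pre /= addr0 block_mul_cons scaler0 mul1mx add0r //.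
Qed.

Lemma unitmx_scales k (B : 'M[R]_k) : B \in unitmx -> scales B.
Proof.
elim: k B => [|k IH] B uB.
  by rewrite (flatmx0 B) -(flatmx0 1%:M); exact: scales1.
have pivot (C : 'M[R]_(1 + k)) : C \in unitmx -> C 0 0 != 0 -> scales C.
  move=> uC C0; set a := C 0 0 in C0; set r := ursubmx C; set u := dlsubmx C.
  (* Elimination with the corner entry; the Schur complement is left to the induction. *)
  have EC : C = block_mx a%:M 0 u (drsubmx C - u *m (a^-1 *: r)) *m
                block_mx 1%:M (a^-1 *: r) 0 1%:M.
    rewrite mulmx_block !mulmx1 !mulmx0 ?mul0mx !addr0 mul_scalar_mx scalerA.
    rewrite mulfV // scale1r addrC subrK -[LHS]submxK; congr block_mx.
    apply/matrixP => i j; rewrite !ord1 !mxE eqxx mulr1n.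
    by rewrite /a; congr (C _ _); apply/val_inj.
  rewrite EC; apply: scales_mul; last exact: scales_shear.
  apply: scales_lblock => //; apply: IH.
  have : \det C \is a GRing.unit by [].
  rewrite {1}EC det_mulmx det_lblock !unitrM.
  by case/andP => /andP[_ uD] _; rewrite unitmxE.
have [B00|] := eqVneq (B 0 0) 0; last exact: pivot.
have [j Bj] : exists j, B (lift 0 j) 0 != 0.
  apply/existsP; apply: contraLR uB; rewrite negb_exists => /forallP B0.
  rewrite unitmxE (expand_det_col _ 0) big1 ?unitr0 // => i _.
  case: (unliftP 0 i) => [i'|] ->; last by rewrite B00 mul0r.
  by move: (B0 i'); rewrite negbK => /eqP ->; rewrite mul0r.
(* [E 1] adds row [lift 0 j] to the first row, which makes the corner entry nonzero, and [E (-1)]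
   undoes it. *)
pose E x : 'M[R]_(1 + k) := block_mx 1%:M (x *: delta_mx 0 j) 0 1%:M.
have EE : E (-1) *m E 1 = 1%:M.
  rewrite /E mulmx_block !mulmx1 !mul1mx !mulmx0 !mul0mx !addr0 add0r scaleN1r.
  by rewrite scale1r subrr [RHS]scalar_mx_block.
rewrite -[B]mul1mx -EE -mulmxA; apply: scales_mul; first exact: scales_shear.
apply: pivot.
  by rewrite unitmx_mul uB andbT unitmxE det_ublock !det1 mulr1 unitr1.
have -> : (E 1 *m B) 0 0 = (E 1 *m col 0 B) 0 0.
  by rewrite !mxE; apply: eq_bigr => i _; rewrite [col 0 B _ _]mxE.
rewrite -(cons_behead_cv (col 0 B)) block_mul_cons cons_cv0 mxE B00 mulr0 add0r.
by rewrite scale1r -rowE !mxE.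
Qed.

Lemma mble_preimage_vol k (B : 'M[R]_k) (c : 'cV[R]_k) (A : set 'cV[R]_k) :
  B \in unitmx -> mble A -> mble [set x | A (B *m x + c)] /\
  (`|\det B|%:E * vol [set x | A (B *m x + c)%R])%E = vol A.
Proof. by move=> uB mA; split; [exact: mble_affine|exact: unitmx_scales]. Qed.

Lemma vol_affine k (B : 'M[R]_k) (c : 'cV[R]_k) (A : set 'cV[R]_k) :
  B \in unitmx -> mble A ->
  mble [set B *m x + c | x in A] /\
  vol [set B *m x + c | x in A] = (`|\det B|%:E * vol A)%E.
Proof.
move=> uB mA.
have E : [set B *m x + c | x in A] = [set y | A (invmx B *m y + - (invmx B *m c))].
  apply/seteqP; split => [_ [x Ax <-]|y Ay] /=.
    by rewrite mulmxDr addrK mulKmx.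
  by exists (invmx B *m y + - (invmx B *m c)) => //; rewrite mulmxDr mulmxN !mulKVmx // subrK.
have mI : mble [set B *m x + c | x in A] by rewrite E; exact: mble_affine.
split => //; rewrite -(unitmx_scales uB c mI); congr (_ * vol _)%E.
apply/seteqP; split => [x [y Ay] /=|x Ax]; last by exists x.
by move=> /addIr /(can_inj (mulKmx uB)) <-.
Qed.

(** If [a] involves a coordinate after the first, every slice is a hyperplane of lower dimension;
    otherwise all slices but one are empty. *)
Lemma vol_hyperplane k (a : 'cV[R]_k) (b : R) : a != 0 ->
  mble [set x | dotv a x = b] /\ vol [set x | dotv a x = b] = 0%E.
Proof.
move=> a0; have mH k' (a' : 'cV[R]_k') b' : mble [set x | dotv a' x = b'].
  rewrite (_ : [set x | _] = [set x | dotv a' x <= b'] `&` [set x | dotv (- a') x <= - b']).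
    by apply: measurableI; exact: mble_halfspace.
  have dN x : dotv (- a') x = - dotv a' x by rewrite /dotv raddfN /= mulNmx mxE.
  apply/seteqP; split => x /=; rewrite dN lerN2.
    by move=> ->.
  by move=> [le1 le2]; apply/eqP; rewrite eq_le le1 le2.
split=> //; elim: k a b a0 => [|k IH] a b; first by rewrite flatmx0 eqxx.
have dotE x y : dotv a (cons_cv x y) = a 0 0 * x + dotv (behead_cv a) y.
  rewrite /dotv [LHS]mxE [X in _ = _ + X]mxE big_ord_recl [_^T _ _]mxE cons_cv0.
  congr (_ + _); apply: eq_bigr => i _.
  by rewrite cons_cvS ![_^T _ _]mxE [behead_cv _ _ _]mxE.
move=> a0; rewrite volS; have [b0|b0] := eqVneq (behead_cv a) 0; last first.
  rewrite integral0_eq // => x _ /=.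
  rewrite -[RHS](IH (behead_cv a) (b - a 0 0 * x) b0); congr vol.
  by apply/seteqP; split => y /=; rewrite dotE; [move=> <-|move=> ->]; ring.
have a00 : a 0 0 != 0.
  apply: contra a0 => /eqP a00; rewrite -(cons_behead_cv a) a00 b0; apply/eqP/matrixP=> i j.
  by case: (unliftP 0 i) => [i'|] ->; rewrite ?cons_cvS ?cons_cv0 ?mxE.
rewrite (@ge0_negligible_integral _ _ _ leb setT [set b / a 0 0]) //; first last.
- exact: lebesgue_measure_set1.
- by move=> x _; exact: vol_ge0.
- exact: (measurable_vol_slice (mH k.+1 a b)).
apply: integral0_eq => x [_ /= xb].
rewrite (_ : [set _ | _] = set0) ?volE ?measure0 //.
apply/seteqP; split => // y /=; rewrite dotE b0 /dotv trmx0 mul0mx mxE addr0 => ab.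
by apply: xb; rewrite -ab; field.
Qed.

Definition cube k (c : R) : set 'cV[R]_k := [set x | forall i, 0 <= x i 0 <= c].

Lemma vol_cube k (c : R) : 0 <= c ->
  mble (@cube k c) /\ vol (@cube k c) = (c ^+ k)%:E.
Proof.
move=> c0; elim: k => [|k [mC vC]].
  have -> : @cube 0 c = setT by apply/seteqP; split => // x _ [].
  split; first exact: measurableT.
  by rewrite volE /pre preimage_setT /= diracT.
have E : pre (@cube k.+1 c) = `[0, c]%classic `*` pre (@cube k c).
  apply/seteqP; split => -[x t]; rewrite /pre /cube /=.
    move=> H; split; first by move: (H 0); rewrite cons_cv0 in_itv.
    by move=> i; move: (H (lift 0 i)); rewrite cons_cvS.
  move=> [x0 H] i; case: (unliftP 0 i) => [i'|] ->; rewrite ?cons_cvS //.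
  by move: x0; rewrite cons_cv0 in_itv.
have mI : measurable (`[0, c]%classic : set (measurableTypeR R)).
  exact: measurable_itv.
split; first by rewrite /mble E; apply: measurableX.
have lI : leb `[0, c]%classic = c%:E.
  rewrite lebesgue_measure_itv /= lte_fin sube0.
  by case: ltP => // c0'; congr _%:E; apply/eqP; rewrite eq_le c0.
by rewrite volE E /= /prod_meas product_measure1E // -volE vC exprS EFinM; congr (_ * _)%E.
Qed.

End ChangeOfVariables.

(** * Convex hulls of finitely many points and the origin *)

Section RankOne.
Variable R : realType.

(** The matrix determinant lemma: the unipotent factors [A] and [C] leave the determinant unchanged
    and exchange the two block triangular forms. *)
Lemma det_rank_one k (u : 'cV[R]_k) (v : 'rV[R]_k) :
  \det (1%:M + u *m v) = 1 + (v *m u) 0 0.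
Proof.
pose A : 'M[R]_(k + 1) := block_mx 1%:M 0 v 1%:M.
pose B : 'M[R]_(k + 1) := block_mx (1%:M + u *m v) u 0 1%:M.
pose C : 'M[R]_(k + 1) := block_mx 1%:M 0 (- v) 1%:M.
have E : A *m B *m C = block_mx 1%:M u 0 (1%:M + v *m u).
  rewrite /A /B /C !mulmx_block !mul1mx ?mul0mx ?mulmx0 ?mulmx1 ?addr0 ?add0r.
  rewrite !mulmxN addrK mulmxDr mulmx1 mulmxDl mul1mx mulmxA [v + _]addrC subrr.
  by rewrite [X in block_mx _ _ _ X]addrC.
have /(congr1 determinant) := E.
rewrite !det_mulmx !det_lblock !det_ublock !det1 !mul1r !mulr1 => ->.
by rewrite det_mx11 !mxE eqxx.
Qed.

Lemma dotvD k (a x y : 'cV[R]_k) : dotv a (x + y) = dotv a x + dotv a y.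
Proof. by rewrite /dotv mulmxDr mxE. Qed.

Lemma dotvZ k (a x : 'cV[R]_k) (t : R) : dotv a (t *: x) = t * dotv a x.
Proof. by rewrite /dotv -scalemxAr mxE. Qed.

Lemma dotvN k (a x : 'cV[R]_k) : dotv a (- x) = - dotv a x.
Proof. by rewrite /dotv mulmxN mxE. Qed.

Lemma dotv0 k (a : 'cV[R]_k) : dotv a 0 = 0.
Proof. by rewrite /dotv mulmx0 mxE. Qed.

Lemma dotv_sum k (a : 'cV[R]_k) (I : Type) (r : seq I) (P : pred I) (F : I -> 'cV[R]_k) :
  dotv a (\sum_(i <- r | P i) F i) = \sum_(i <- r | P i) dotv a (F i).
Proof. by rewrite /dotv mulmx_sumr summxE. Qed.

Lemma mulmx_col k m (Q : 'M[R]_(k, m)) (c : 'cV[R]_m) :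
  Q *m c = \sum_j c j 0 *: col j Q.
Proof.
apply/matrixP => i j; rewrite !mxE summxE; apply: eq_bigr => l _.
by rewrite !mxE (ord1 j) mulrC.
Qed.

Lemma dotv_mulmx k m (a : 'cV[R]_k) (Q : 'M[R]_(k, m)) (c : 'cV[R]_m) :
  dotv a (Q *m c) = \sum_j c j 0 * dotv a (col j Q).
Proof. by rewrite mulmx_col dotv_sum; apply: eq_bigr => j _; rewrite dotvZ. Qed.

End RankOne.

(** * Pivots of the simplex method *)

Section Polytope.
Variables (R : realType) (k m : nat) (Q : 'M[R]_(k, m)).
Implicit Types (f : {ffun 'I_k -> 'I_m}) (J : {set 'I_m}).

Definition bmx f : 'M[R]_k := colsub f Q.
Definition coords f (x : 'cV[R]_k) : 'cV[R]_k := invmx (bmx f) *m x.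
Definition csum n (u : 'cV[R]_n) : R := \sum_i u i 0.
Definition pos n (u : 'cV[R]_n) := forall i, 0 <= u i 0.

Definition swap_in f (i : 'I_k) (j : 'I_m) : {ffun 'I_k -> 'I_m} :=
  [ffun l => if l == i then j else f l].

Lemma csumD n (u v : 'cV[R]_n) : csum (u + v) = csum u + csum v.
Proof. by rewrite /csum -big_split; apply: eq_bigr => i _; rewrite mxE. Qed.

Lemma csumZ n (t : R) (u : 'cV[R]_n) : csum (t *: u) = t * csum u.
Proof. by rewrite /csum mulr_sumr; apply: eq_bigr => i _; rewrite mxE. Qed.

Lemma addZE n (u d : 'cV[R]_n) t i : (u + t *: d) i 0 = u i 0 + t * d i 0.
Proof. by rewrite !mxE. Qed.

Lemma bmx_swap_unit f i j : bmx f \in unitmx -> coords f (col j Q) i 0 != 0 ->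
  bmx (swap_in f i j) \in unitmx.
Proof.
move=> uf di; set d := coords f (col j Q) in di.
have E : bmx (swap_in f i j) = bmx f *m (1%:M + (d - delta_mx i 0) *m delta_mx 0 i).
  rewrite mulmxDr mulmx1 mulmxA mulmxBr /d /coords mulKVmx // -colE.
  apply/matrixP => a b; rewrite !mxE big_ord_recl big_ord0 !mxE ffunE addr0.
  by rewrite eqxx /=; case: eqP => [->|_]; rewrite ?mulr1 ?mulr0 ?addr0 // addrC subrK.
rewrite E unitmx_mul uf unitmxE det_rank_one -rowE unitfE.
have -> : (row i (d - delta_mx i 0)) 0 0 = d i 0 - 1.
  by rewrite !mxE !eqxx.
by rewrite addrC subrK.
Qed.

(** The coefficients after column [j], with coordinates [d], has replaced the [i]-th basis column: a
    part [t] of its coefficient [g] is spread along [d], chosen to cancel the [i]-th coordinate, and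
    [g - t] stays on the new column. *)
Definition pivot_vec (u d : 'cV[R]_k) (t g : R) i : 'cV[R]_k :=
  \col_l (if l == i then g - t else u l 0 + t * d l 0).

Lemma bmx_swap_mul f i j (u : 'cV[R]_k) (t g : R) : bmx f \in unitmx ->
  let d := coords f (col j Q) in u i 0 + t * d i 0 = 0 ->
  bmx (swap_in f i j) *m pivot_vec u d t g i = bmx f *m u + g *: col j Q.
Proof.
move=> uf d ui.
have -> : bmx f *m u + g *: col j Q = bmx f *m (u + t *: d) + (g - t) *: col j Q.
  rewrite mulmxDr -scalemxAr /d /coords mulKVmx // scalerBl -addrA.
  by congr (_ + _); rewrite [RHS]addrC subrK.
clearbody d; apply/matrixP => a b; rewrite !mxE (bigD1 i) //= [in RHS](bigD1 i) //= !mxE.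
rewrite ffunE eqxx (ord1 b) ui mulr0 add0r (mulrC (Q a j)) [RHS]addrC; congr (_ + _).
by apply: eq_bigr => l li; rewrite !mxE ffunE (negbTE li).
Qed.

Lemma csum_pivot (u d : 'cV[R]_k) (t g : R) i : u i 0 + t * d i 0 = 0 ->
  csum (pivot_vec u d t g i) = csum u + g + t * (csum d - 1).
Proof.
move=> ui.
have -> : csum u + g + t * (csum d - 1) = csum (u + t *: d) + (g - t).
  by rewrite csumD csumZ; ring.
rewrite /csum (bigD1 i) //= [in RHS](bigD1 i) //= !mxE eqxx ui add0r addrC.
by congr (_ + _); apply: eq_bigr => l li; rewrite !mxE (negbTE li).
Qed.

(** The coordinate with the smallest ratio is the first to vanish along [d], so the others are still
    nonnegative there. *)
Lemma ratio_test (u d : 'cV[R]_k) (l : 'I_k) : pos u -> d l 0 < 0 ->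
  exists i, d i 0 < 0 /\ pos (u + (u i 0 / - d i 0) *: d) /\
    u i 0 / - d i 0 <= u l 0 / - d l 0.
Proof.
move=> u0 dl; pose F i := u i 0 / - d i 0.
case: (@arg_minP _ _ _ l (fun i => d i 0 < 0) F dl) => i di Fi.
exists i; split=> //; split; last exact: Fi.
move=> b; rewrite !mxE; have [db|db] := leP 0 (d b 0).
  apply: addr_ge0; first exact: u0.
  by apply: mulr_ge0 => //; apply: divr_ge0; rewrite ?oppr_ge0 ?(ltW di).
have := Fi b db; rewrite /F => le; rewrite -[X in _ + X]opprK subr_ge0 -mulrN.
by rewrite -ler_pdivlMr ?oppr_gt0.
Qed.

(* A simplex pivot: column [j] enters the basis with a coefficient larger than
   [g], and a basis column leaves. *)
Lemma pivot_out f (u : 'cV[R]_k) j (g : R) : bmx f \in unitmx -> pos u -> 0 <= g ->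
    1 < csum (coords f (col j Q)) ->
  exists i u' t, let d := coords f (col j Q) in
    [/\ bmx (swap_in f i j) \in unitmx, pos u',
        bmx (swap_in f i j) *m u' = bmx f *m u + g *: col j Q,
        csum u' = csum u + g - t * (csum d - 1) & t * d i 0 = u i 0 /\ 0 <= t].
Proof.
move=> uf u0 g0 s1; set d := coords f (col j Q) in s1 *.
have [l dl] : exists l, 0 < d l 0.
  apply/existsP; apply: contraLR s1; rewrite negb_exists => /forallP dn.
  rewrite -leNgt (le_trans _ ler01) // sumr_le0 // => i _.
  by rewrite leNgt.
(* Moving against [d] raises the coefficient of column [j] to [g + t] and does not raise the total,
   since the coordinates [d] sum to more than 1. *)
have dNl : (- d) l 0 < 0 by rewrite mxE oppr_lt0.
have [i [di [pu _]]] := ratio_test u0 dNl.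
move: di pu; rewrite mxE oppr_lt0 opprK => di pu.
set t := u i 0 / d i 0 in pu.
have t0 : 0 <= t by rewrite divr_ge0 // ltW.
have ti : t * d i 0 = u i 0 by rewrite divfK // gt_eqF.
have ui : u i 0 + (- t) * d i 0 = 0 by rewrite mulNr ti subrr.
exists i, (pivot_vec u d (- t) g i), t; split=> //.
- by apply: bmx_swap_unit => //; rewrite gt_eqF.
- move=> b; rewrite mxE opprK; case: eqP => _; first exact: addr_ge0.
  by have := pu b; rewrite addZE [(- d) b 0]mxE mulNr mulrN.
- exact: bmx_swap_mul.
- by rewrite csum_pivot // mulNr.
Qed.

(* Column [j] enters the basis as far as its available coefficient [g] allows. *)
Lemma pivot_in f (u : 'cV[R]_k) j (g : R) : bmx f \in unitmx -> pos u -> 0 <= g ->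
    csum (coords f (col j Q)) <= 1 ->
  exists (f' : {ffun 'I_k -> 'I_m}) u',
    [/\ f' = f \/ (exists i, f' = swap_in f i j), bmx f' \in unitmx, pos u',
        bmx f' *m u' = bmx f *m u + g *: col j Q & csum u' <= csum u + g].
Proof.
move=> uf u0 g0 s1; set d := coords f (col j Q) in s1.
have [ud|] := boolP [forall l, 0 <= u l 0 + g * d l 0].
  exists f, (u + g *: d); split=> //; first by left.
  - by move=> l; rewrite addZE; exact: (forallP ud).
  - by rewrite mulmxDr -scalemxAr /d /coords mulKVmx.
  - by rewrite csumD csumZ lerD2l ler_piMr.
rewrite negb_forall => /existsP[l]; rewrite -ltNge => udl.
have dl : d l 0 < 0.
  rewrite ltNge; apply/negP => dl; move: udl; rewrite ltNge addr_ge0 //.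
  exact: mulr_ge0.
have [i [di [pu le]]] := ratio_test u0 dl.
set t := u i 0 / - d i 0 in pu le.
(* Coordinate [l] is already negative at [g], so the ratio test stops no later than [g], and column
   [j] keeps the coefficient [g - t >= 0]. *)
have tg : t <= g.
  apply: (le_trans le); rewrite ler_pdivrMr ?oppr_gt0 // mulrN.
  by rewrite -subr_le0 opprK ltW.
have t0 : 0 <= t by rewrite divr_ge0 // oppr_ge0 ltW.
have ui : u i 0 + t * d i 0 = 0 by rewrite /t invrN mulrN mulNr divfK ?subrr // lt_eqF.
exists (swap_in f i j), (pivot_vec u d t g i); split.
- by right; exists i.
- by apply: bmx_swap_unit => //; rewrite lt_eqF.
- move=> b; rewrite mxE; case: eqP => _; first by rewrite subr_ge0.
  by have := pu b; rewrite addZE.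
- exact: bmx_swap_mul.
- by rewrite csum_pivot // gerDl mulr_ge0_le0 // subr_le0.
Qed.

Definition basis_in J f := (forall i, f i \in J) /\ bmx f \in unitmx.

Lemma basis_in_swap J f i j : (forall i, f i \in J) -> j \in J ->
  forall l, swap_in f i j l \in J.
Proof. by move=> fJ jJ l; rewrite ffunE; case: eqP. Qed.

(* The columns used by [c] are pivoted one by one into the basis [f]. *)
Lemma caratheodory_step J f (u : 'cV[R]_k) (c : 'cV[R]_m) : basis_in J f ->
    pos u -> pos c -> (forall j, j \notin J -> c j 0 = 0) ->
  exists f' u', [/\ basis_in J f', pos u', csum u' <= csum u + csum c &
    bmx f' *m u' = bmx f *m u + Q *m c].
Proof.
move: {2}#|(finset (fun j => c j 0 != 0))| (leqnn #|(finset (fun j => c j 0 != 0))|) => N.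
elim: N f u c => [|N IH] f u c.
  rewrite leqn0 cards_eq0 => /eqP c0 fJ u0 _ _.
  have {}c0 : c = 0.
    apply/matrixP => j b; rewrite (ord1 b) mxE; apply/eqP.
    by have /setP/(_ j) := c0; rewrite !inE => /negbT; rewrite negbK.
  exists f, u; split => //; last by rewrite c0 mulmx0 addr0.
  by rewrite c0 /csum [X in _ + X]big1 ?addr0 // => i _; rewrite mxE.
move=> cN [fJ uf] u0 c0 cJ.
have [c1|[j]] := set_0Vmem (finset (fun j => c j 0 != 0)).
  by apply: IH => //; rewrite c1 cards0.
rewrite inE => cj; have jJ : j \in J by apply: contraNT cj => /cJ ->.
pose c' : 'cV[R]_m := \col_l (if l == j then 0 else c l 0).
have Qc : Q *m c = c j 0 *: col j Q + Q *m c'.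
  rewrite !mulmx_col (bigD1 j) //= [in RHS](bigD1 j) //= mxE eqxx scale0r add0r.
  by congr (_ + _); apply: eq_bigr => l lj; rewrite mxE (negbTE lj).
have Sc : csum c = c j 0 + csum c'.
  rewrite /csum (bigD1 j) //= [in RHS](bigD1 j) //= mxE eqxx add0r.
  by congr (_ + _); apply: eq_bigr => l lj; rewrite mxE (negbTE lj).
have [f1 [u1 [f1J u10 f1E f1S]]] : exists f' u',
    [/\ basis_in J f', pos u', bmx f' *m u' = bmx f *m u + c j 0 *: col j Q &
        csum u' <= csum u + c j 0].
  (* Choosing the kind of pivot by this sum keeps the total coefficient from growing. *)
  have [s1|s1] := leP (csum (coords f (col j Q))) 1.
    have [f' [u' [ff' uf' u'0 E S]]] := pivot_in uf u0 (c0 j) s1.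
    exists f', u'; split=> //; split=> //.
    by case: ff' => [->//|[i ->]]; exact: basis_in_swap.
  have [i [u' [t [uf' u'0 E S [_ t0]]]]] := pivot_out uf u0 (c0 j) s1.
  exists (swap_in f i j), u'; split=> //.
    by split=> //; exact: basis_in_swap.
  by rewrite S gerBl mulr_ge0 // subr_ge0 ltW.
have [|l|l lJ|f2 [u2 [f2J u20 f2S f2E]]] := IH f1 u1 c' _ f1J u10.
- rewrite -ltnS (leq_trans _ cN) // proper_card //; apply/properP; split.
    by apply/fintype.subsetP => l; rewrite !inE mxE; case: (l == j); rewrite ?eqxx.
  by exists j; rewrite !inE // mxE eqxx eqxx.
- by rewrite mxE; case: eqP.
- by rewrite mxE cJ // if_same.
exists f2, u2; split=> //.
  by rewrite (le_trans f2S) // Sc addrA lerD2r.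
by rewrite f2E f1E Qc addrA.
Qed.

End Polytope.

(** * Measurable sets and null sets *)

Section Null.
Variables (R : realType) (k : nat).
Implicit Types A B : set 'cV[R]_k.

Lemma mbleI A B : mble A -> mble B -> mble (A `&` B).
Proof. exact: measurableI. Qed.

Lemma mbleU A B : mble A -> mble B -> mble (A `|` B).
Proof. exact: measurableU. Qed.

Lemma mbleC A : mble A -> mble (~` A).
Proof. exact: measurableC. Qed.

Lemma mbleD A B : mble A -> mble B -> mble (A `\` B).
Proof. exact: measurableD. Qed.

Lemma mble_bigcup (I : finType) (D : set I) (F : I -> set 'cV[R]_k) :
  (forall i, D i -> mble (F i)) -> mble (\bigcup_(i in D) F i).
Proof.
move=> mF; rewrite /mble /pre preimage_bigcup.
by apply: fin_bigcup_measurable => //; exact: finite_finset.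
Qed.

Lemma mble_bigcap (I : finType) (D : set I) (F : I -> set 'cV[R]_k) :
  (forall i, D i -> mble (F i)) -> mble (\bigcap_(i in D) F i).
Proof.
move=> mF; rewrite -[X in mble X]setCK setC_bigcap.
by apply: mbleC; apply: mble_bigcup => i Di; apply: mbleC; exact: mF.
Qed.

Lemma vol_le A B : mble A -> mble B -> A `<=` B -> (vol A <= vol B)%E.
Proof.
by move=> mA mB AB; rewrite !volE; apply: le_measure; rewrite ?inE // => t; exact: AB.
Qed.

Lemma volU_le A B : mble A -> mble B -> (vol (A `|` B) <= vol A + vol B)%E.
Proof. by move=> mA mB; rewrite !volE; exact: measureU2. Qed.

Definition null A := mble A /\ vol A = 0%E.

Lemma nullU A B : null A -> null B -> null (A `|` B).
Proof.
move=> [mA vA] [mB vB]; split; first exact: mbleU.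
apply/eqP; rewrite eq_le vol_ge0 andbT (le_trans (volU_le mA mB)) //.
by rewrite vA vB adde0.
Qed.

Lemma null_set0 : null set0.
Proof. by split; [exact: measurable0|rewrite volE /pre preimage_set0 measure0]. Qed.

Lemma null_bigcup (I : finType) (D : set I) (F : I -> set 'cV[R]_k) :
  (forall i, D i -> null (F i)) -> null (\bigcup_(i in D) F i).
Proof.
move=> nF; rewrite bigcup_mkcond.
have -> : [set: I] = [set` enum I] by apply/seteqP; split => // i _; rewrite /= mem_enum.
rewrite bigcup_seq; elim/big_ind: _ => [|A B nA nB|i _].
- exact: null_set0.
- exact: nullU.
- by case: ifPn => [/set_mem /nF //|_]; exact: null_set0.
Qed.

Lemma vol_diff_null A B : mble A -> null B -> vol (A `\` B) = vol A.
Proof.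
move=> mA [mB vB]; apply/eqP; rewrite eq_le (vol_le (mbleD mA mB) mA) //=.
apply: (@le_trans _ _ (vol ((A `\` B) `|` B))).
  apply: vol_le => //; first by apply: mbleU => //; exact: mbleD.
  by move=> x Ax; have [Bx|nBx] := pselect (B x); [right|left].
by rewrite (le_trans (volU_le (mbleD mA mB) mB)) // vB adde0.
Qed.

End Null.

(** * Hulls with apex 0 as unions of simplices *)

Section Hull.
Variables (R : realType) (k m : nat) (Q : 'M[R]_(k, m)).
Implicit Types (f : {ffun 'I_k -> 'I_m}) (J : {set 'I_m}).

(** The inequality on [csum c] adds the apex 0. The pyramids over facets and, by symmetry, P itself
    are instances of this one construction. *)
Definition hull0 J : set 'cV[R]_k := [set x | exists c : 'cV[R]_m,
  [/\ pos c, (forall j, j \notin J -> c j 0 = 0), csum c <= 1 & x = Q *m c]].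

(* [push f u] are coefficients on the columns of [Q] for the combination [u] of the
   columns selected by [f], which need not be distinct. *)
Definition push f (u : 'cV[R]_k) : 'cV[R]_m := \col_j \sum_(i | f i == j) u i 0.

Lemma csum_push f u : csum (push f u) = csum u.
Proof.
rewrite /csum [RHS](partition_big f predT) //=.
by apply: eq_bigr => j _; rewrite mxE.
Qed.

Lemma mulmx_push f u : Q *m push f u = bmx Q f *m u.
Proof.
rewrite !mulmx_col [RHS](partition_big f predT) //=.
apply: eq_bigr => j _; rewrite mxE scaler_suml; apply: eq_bigr => i /eqP <-.
by congr (_ *: _); apply/matrixP => a b; rewrite !mxE.
Qed.

Lemma pos_push f u : pos u -> pos (push f u).
Proof. by move=> u0 j; rewrite mxE sumr_ge0. Qed.

Lemma hull0_push J f u : (forall i, f i \in J) -> pos u -> csum u <= 1 ->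
  hull0 J (bmx Q f *m u).
Proof.
move=> fJ u0 u1; exists (push f u); split; rewrite ?csum_push ?mulmx_push //.
  exact: pos_push.
move=> j jJ; rewrite mxE big1 // => i /eqP fi.
by move: jJ; rewrite -fi fJ.
Qed.

Definition simplex0 f : set 'cV[R]_k :=
  [set x | pos (coords Q f x) /\ csum (coords Q f x) <= 1].

(** Caratheodory's theorem with apex 0: starting from the basis [f0] with zero coefficients, all
    columns are pivoted in. *)
Lemma hull0E J f0 : basis_in Q J f0 ->
  hull0 J = \bigcup_(f in [set f | basis_in Q J f]) simplex0 f.
Proof.
move=> fJ; apply/seteqP; split => x.
  move=> [c [c0 cJ c1 ->]].
  have p0 : pos (0 : 'cV[R]_k) by move=> i; rewrite mxE.
  have [f [u [fb u0 uS E]]] := caratheodory_step fJ p0 c0 cJ.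
  have [_ uf] := fb; exists f => //; rewrite /simplex0 /=.
  rewrite -[Q *m c]add0r -[X in X + _](mulmx0 _ (bmx Q f0)) -E /coords mulKmx //.
  by split=> //; apply: (le_trans uS); rewrite {1}/csum big1 ?add0r // => i _; rewrite mxE.
move=> [f [fb uf]] [u0 u1].
by rewrite -[x](mulKVmx uf); exact: hull0_push.
Qed.

Definition std_simplex : set 'cV[R]_k := [set u | pos u /\ csum u <= 1].

Lemma mble_std_simplex : mble std_simplex.
Proof.
have -> : std_simplex =
    (\bigcap_(i in [set: 'I_k]) [set u | dotv (- delta_mx i 0) u <= 0]) `&`
    [set u | dotv (const_mx 1) u <= 1].
  have dE (i : 'I_k) (u : 'cV[R]_k) : dotv (- delta_mx i 0) u = - u i 0.
    by rewrite /dotv raddfN /= trmx_delta mulNmx -rowE !mxE.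
  have sE (u : 'cV[R]_k) : dotv (const_mx 1) u = csum u.
    by rewrite /dotv mxE; apply: eq_bigr => i _; rewrite !mxE mul1r.
  apply/seteqP; split => u [u0 u1]; split; rewrite /= ?sE // in u1 *.
    by move=> i _ /=; rewrite dE oppr_le0.
  by move=> i; have := u0 i Logic.I; rewrite /= dE oppr_le0.
apply: mbleI; last exact: mble_halfspace.
by apply: mble_bigcap => i _; exact: mble_halfspace.
Qed.

Lemma mble_hull0 J f0 : basis_in Q J f0 -> mble (hull0 J).
Proof.
move=> fJ; rewrite (hull0E fJ); apply: mble_bigcup => f _.
rewrite (_ : simplex0 f = [set x | std_simplex (invmx (bmx Q f) *m x + 0)]).
  exact/mble_affine/mble_std_simplex.
by apply/funext => x; rewrite /= addr0.
Qed.

Lemma vol_hull0_fin J f0 : basis_in Q J f0 -> (vol (hull0 J) < +oo)%E.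
Proof.
move=> fJ; pose M := \sum_a \sum_j `|Q a j|.
have M0 : 0 <= M by apply: sumr_ge0 => a _; apply: sumr_ge0.
have [mC vC] := @vol_cube R k (M + M) (addr_ge0 M0 M0).
have [mP vP] := mble_preimage_vol (const_mx M) (unitmx1 R k) mC.
rewrite det1 normr1 mul1e in vP.
apply: (@le_lt_trans _ _ (vol [set x | cube (M + M) (1%:M *m x + const_mx M)])).
  apply: vol_le => //; first exact: mble_hull0 fJ.
  move=> t [c [c0 _ c1 ->]] i; rewrite mul1mx mxE [const_mx _ _ _]mxE.
  have : `|(Q *m c) i 0| <= M.
    rewrite mxE (le_trans (ler_norm_sum _ _ _)) //.
    apply: (@le_trans _ _ (\sum_j `|Q i j|)).
      apply: ler_sum => j _; rewrite normrM ler_piMr // ger0_norm; last exact: c0.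
      apply: le_trans c1; rewrite /csum (bigD1 j) //= lerDl.
      by apply: sumr_ge0 => l _; exact: c0.
    rewrite /M (bigD1 i) //= lerDl.
    by apply: sumr_ge0 => a _; exact: sumr_ge0.
  by rewrite ler_norml; lra.
by rewrite vP vC ltry.
Qed.

Lemma vol_hull0_gt0 J f0 : (0 < k)%N -> basis_in Q J f0 -> (0 < vol (hull0 J))%E.
Proof.
move=> k0 fJ; have [f0J uf] := fJ.
have kR : 0 < (k%:R : R) by rewrite ltr0n.
(* A cube of side [1 / k] fits into the standard simplex. *)
have [mC vC] := @vol_cube R k k%:R^-1 (ltW (etrans (invr_gt0 _) kR)).
have [mI vI] := vol_affine 0 uf mC.
apply: (@lt_le_trans _ _ (`|\det (bmx Q f0)|%:E * vol (@cube R k k%:R^-1))%E).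
  by rewrite vC -EFinM lte_fin mulr_gt0 ?exprn_gt0 ?invr_gt0 // normr_gt0 -unitfE -unitmxE.
rewrite -vI; apply: vol_le => //; first exact: mble_hull0 fJ.
move=> t [u uC /= <-]; rewrite addr0; apply: hull0_push => //.
  by move=> i; have /andP[] := uC i.
rewrite /csum (le_trans (ler_sum _ (G := fun=> k%:R^-1) _)) //.
  by move=> i _; have /andP[] := uC i.
by rewrite sumr_const card_ord -[leLHS]mulr_natr mulVf // gt_eqF.
Qed.

(* Generic points avoid the hyperplanes spanned by [k - 1] independent columns. *)
Definition generic (x : 'cV[R]_k) :=
  forall f, bmx Q f \in unitmx -> forall i, coords Q f x i 0 != 0.

Lemma null_nongeneric : null (~` generic).
Proof.
pose H (fi : {ffun 'I_k -> 'I_m} * 'I_k) : set 'cV[R]_k :=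
  [set x | dotv (row fi.2 (invmx (bmx Q fi.1)))^T x = 0].
have HE fi x : H fi x <-> coords Q fi.1 x fi.2 0 = 0.
  by rewrite /H /= /dotv trmxK -row_mul mxE.
pose D := [set fi : {ffun 'I_k -> 'I_m} * 'I_k | bmx Q fi.1 \in unitmx].
have E : ~` generic = \bigcup_(fi in D) H fi.
  apply/seteqP; split => x.
    move=> /existsNP[f /not_implyP[uf /existsNP[i /negP]]]; rewrite negbK => /eqP xi.
    by exists (f, i) => //; apply/HE.
  by move=> [[f i] uf /HE xi] g; have := g f uf i; rewrite xi eqxx.
have HN fi : D fi -> null (H fi).
  move=> uf; apply: vol_hyperplane; apply/eqP => /(congr1 trmx).
  rewrite trmxK trmx0 rowE => e0.
  have := congr1 (mulmx^~ (bmx Q fi.1)) e0.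
  rewrite /= mulmxKV // mul0mx => /matrixP/(_ 0 fi.2) /eqP.
  by rewrite !mxE !eqxx oner_eq0.
by rewrite E; exact: null_bigcup.
Qed.

End Hull.

Lemma dotvBl (R : realType) k (a b x : 'cV[R]_k) :
  dotv (a - b) x = dotv a x - dotv b x.
Proof. by rewrite /dotv raddfB /= mulmxBl [LHS]mxE; congr (_ + _); rewrite mxE. Qed.

(** * Facets *)

Section Facets.
Variables (R : realType) (k m : nat) (Q : 'M[R]_(k, m)).
Implicit Types (f : {ffun 'I_k -> 'I_m}) (J : {set 'I_m}).

Definition valid J (a : 'cV[R]_k) :=
  (forall j, dotv a (col j Q) <= 1) /\
  (forall j, (j \in J) = (dotv a (col j Q) == 1)).

(* [J] is the set of columns of [Q] on a facet, whose supporting hyperplane is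
   normalised to have right-hand side 1. *)
Definition facet_set J := (exists a, valid J a) /\ (exists f, basis_in Q J f).

Definition normal J : 'cV[R]_k := xget 0 [set a | valid J a].

Lemma facet_normalP J : facet_set J -> valid J (normal J).
Proof. by move=> [[a va] _]; exact: (@xgetPex _ 0 [set a | valid J a] (ex_intro _ a va)). Qed.

Lemma normal_inj J J' : facet_set J -> facet_set J' -> normal J = normal J' -> J = J'.
Proof.
move=> /facet_normalP[_ vJ] /facet_normalP[_ vJ'] E; apply/setP => j.
by rewrite vJ vJ' E.
Qed.

(** On the pyramid over [J] its normal returns the sum of the coefficients, because it is 1 on the
    columns used; any other normal is at most 1 on each of them. *)
Lemma hull0_normal J J' x : facet_set J -> facet_set J' -> hull0 Q J x ->
  [/\ 0 <= dotv (normal J) x, dotv (normal J) x <= 1 &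
      dotv (normal J') x <= dotv (normal J) x].
Proof.
move=> /facet_normalP[vJ1 vJ] /facet_normalP[vJ'1 _] [c [c0 cJ c1 ->]].
have E : dotv (normal J) (Q *m c) = csum c.
  rewrite dotv_mulmx; apply: eq_bigr => j _.
  have [|/cJ ->] := boolP (j \in J); last by rewrite mul0r.
  by rewrite vJ => /eqP ->; rewrite mulr1.
rewrite E; split=> //; first exact: sumr_ge0.
by rewrite dotv_mulmx; apply: ler_sum => j _; rewrite ler_piMr.
Qed.

Lemma hull0_dotv a x : (forall j, dotv a (col j Q) <= 1) -> hull0 Q [set: 'I_m]%SET x ->
  dotv a x <= 1.
Proof.
move=> a1 [c [c0 _ c1 ->]]; rewrite dotv_mulmx (le_trans _ c1) //.
by apply: ler_sum => j _; rewrite ler_piMr.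
Qed.

(* Among the bases in which [x] has nonnegative coordinates, take one minimising
   their sum: this linear form is the normal of a facet, for otherwise a pivot
   would decrease the sum, strictly because [x] is generic. *)
Lemma generic_facet f0 x : bmx Q f0 \in unitmx -> generic Q x ->
  hull0 Q [set: 'I_m]%SET x -> exists J, facet_set J /\ hull0 Q J x.
Proof.
move=> uf0 gx Px.
have b0 : basis_in Q [set: 'I_m]%SET f0 by split=> // i; rewrite inE.
pose feas f := (bmx Q f \in unitmx) && [forall i, 0 <= coords Q f x i 0].
have [f1 f1x] : exists f, feas f.
  move: Px; rewrite (hull0E b0) => -[f [_ uf] [f_pos _]]; exists f.
  by rewrite /feas uf; apply/forallP.
case: (@arg_minP _ _ _ f1 feas (fun f => csum (coords Q f x)) f1x) => f /andP[uf /forallP fx] fmin.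
(* The dual solution of the linear program: the form equal to 1 on every basis column. *)
pose a : 'cV[R]_k := (const_mx 1 *m invmx (bmx Q f))^T.
have aE y : dotv a y = csum (coords Q f y).
  rewrite /dotv trmxK -mulmxA -/(coords Q f y) mxE.
  by apply: eq_bigr => i _; rewrite mxE mul1r.
have a1 j : dotv a (col j Q) <= 1.
  rewrite leNgt aE; apply/negP => s1.
  have [i [u' [t [uf' u'0 E S [ti t0]]]]] := pivot_out uf fx (lexx 0) s1.
  have tp : 0 < t.
    rewrite lt_neqAle t0 andbT eq_sym; apply: contraTneq (gx f uf i) => t00.
    by rewrite negbK -ti t00 mul0r.
  have E' : coords Q (swap_in f i j) x = u'.
    have -> : x = bmx Q (swap_in f i j) *m u'.
      by rewrite E scale0r addr0 /coords mulKVmx.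
    by rewrite /coords mulKmx.
  have /fmin : feas (swap_in f i j) by rewrite /feas uf' E'; apply/forallP.
  by rewrite E' S addr0 leNgt gtrBl mulr_gt0 // subr_gt0.
pose J := finset (fun j => dotv a (col j Q) == 1).
have fJ i : f i \in J.
  have fi : col (f i) Q = bmx Q f *m delta_mx i 0.
    by rewrite -colE; apply/matrixP => p q; rewrite !mxE.
  rewrite inE aE /coords fi mulKmx // /csum (bigD1 i) //= mxE !eqxx big1 ?addr0 // => l li.
  by rewrite mxE (negbTE li).
exists J; split.
  by split; [exists a; split=> // j; rewrite inE|exists f; split].
rewrite -[x](mulKVmx uf); apply: hull0_push => //.
by rewrite -/(coords Q f x) -aE; exact: hull0_dotv Px.
Qed.

End Facets.

(** * Volumes of disjoint families and of unions *)

Section VolumeSums.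
Variables (R : realType) (k : nat).

Lemma vol_diff (F K : set 'cV[R]_k) : mble F -> mble K -> F `<=` K ->
  vol K = (vol F + vol (K `\` F))%E.
Proof.
move=> mF mK FK; rewrite -[in X in (X + _)%E](setIidr FK) addeC !volE.
exact: (measureDI (sfmeas (euclid R k)) mK mF).
Qed.

Lemma vol_sum_le (I : eqType) (s : seq I) (F : I -> set 'cV[R]_k) (K : set 'cV[R]_k) :
  uniq s -> mble K -> (forall i, i \in s -> mble (F i) /\ F i `<=` K) ->
  (forall i j, i \in s -> j \in s -> i != j -> F i `&` F j = set0) ->
  (\sum_(i <- s) vol (F i) <= vol K)%E.
Proof.
elim: s K => [|i s IH] K; first by rewrite big_nil vol_ge0.
move=> /= /andP[is_ us] mK FK Fd.
have [mFi FiK] := FK i (mem_head _ _).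
rewrite (vol_diff mFi mK FiK).
rewrite big_cons leeD2l //; apply: IH => //; first exact: mbleD.
  move=> j js; have [mFj FjK] := FK j (mem_behead (s := i :: s) js).
  split=> // x Fjx; split; first exact: FjK.
  move=> Fix; have : (F i `&` F j) x by [].
  rewrite Fd ?mem_head ?inE ?js ?orbT //.
  by apply: contraNneq is_ => ->.
by move=> j l js ls; apply: Fd; rewrite inE ?js ?ls orbT.
Qed.

Lemma vol_bigcup_le (I : choiceType) (s : seq I) (F : I -> set 'cV[R]_k) :
  (forall i, i \in s -> mble (F i)) ->
  mble (\bigcup_(i in [set` s]) F i) /\
  (vol (\bigcup_(i in [set` s]) F i) <= \sum_(i <- s) vol (F i))%E.
Proof.
rewrite bigcup_seq; elim: s => [|i s IH] mF.
  rewrite !big_nil.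
  by have [mN ->] := @null_set0 R k.
have mFi := mF i (mem_head _ _).
have [|mU leU] := IH; first by move=> j js; apply: mF; rewrite inE js orbT.
rewrite !big_cons; split; first exact: mbleU.
by apply: (le_trans (volU_le mFi mU)); rewrite leeD2l.
Qed.

End VolumeSums.

(* [tip J] maps the pyramid over the facet [J] with apex 0 onto the pyramid over
   the same facet with apex [q J], fixing the facet pointwise. If [tip J x] and
   [tip J' x'] coincide, comparing the values of both normals shows that they
   agree at [x'], so the images are disjoint up to a null set. *)
Section PushOut.
Variables (R : realType) (k m : nat) (Q : 'M[R]_(k, m)).
Variables (s : seq {set 'I_m}) (q : {set 'I_m} -> 'cV[R]_k) (t : R).
Hypothesis us : uniq s.
Hypothesis t0 : 0 < t.
Hypothesis sF : forall J, J \in s -> facet_set Q J.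
Hypothesis q_eq : forall J, J \in s -> dotv (normal Q J) (q J) = 1 + t.
Hypothesis q_le : forall J J', J \in s -> J' \in s -> dotv (normal Q J) (q J') <= 1 + t.

Definition tip J x := x + (1 - dotv (normal Q J) x) *: q J.

(** The first union contains the points where images of two pyramids could meet; the second one
    contains the facets, which [tip] fixes and so leaves inside the hull. *)
Let N : set 'cV[R]_k :=
  (\bigcup_(p in [set p : {set 'I_m} * {set 'I_m} | [&& p.1 \in s, p.2 \in s & p.1 != p.2]])
    [set x | dotv (normal Q p.1 - normal Q p.2) x = 0]) `|`
  (\bigcup_(J in [set J : {set 'I_m} | J \in s]) [set x | dotv (normal Q J) x = 1]).

Let null_N : null N.
Proof.
apply: nullU; apply: null_bigcup.
  move=> [J J'] /= /and3P[Js J's JJ']; apply: vol_hyperplane.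
  rewrite subr_eq0; apply: contra JJ' => /eqP E; apply/eqP.
  exact: normal_inj (sF Js) (sF J's) E.
move=> J Js; apply: vol_hyperplane; apply/eqP => E.
have := q_eq Js; rewrite E /dotv trmx0 mul0mx mxE.
by move=> /esym/eqP; rewrite gt_eqF // addr_gt0.
Qed.

Let dotv_tip J J' x : dotv (normal Q J) (tip J' x) =
  dotv (normal Q J) x + (1 - dotv (normal Q J') x) * dotv (normal Q J) (q J').
Proof. by rewrite /tip dotvD dotvZ. Qed.

Let dotv_tipJ J x : J \in s ->
  dotv (normal Q J) (tip J x) = 1 + t * (1 - dotv (normal Q J) x).
Proof. by move=> Js; rewrite dotv_tip q_eq //; ring. Qed.

(** [tip J] is affine, and its linear part is a rank-one perturbation of the identity with
    determinant [1 - (1 + t) = - t]. *)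
Let vol_tip J : J \in s ->
  mble [set tip J x | x in hull0 Q J `\` N] /\
  vol [set tip J x | x in hull0 Q J `\` N] = (t%:E * vol (hull0 Q J))%E.
Proof.
move=> Js; pose B := 1%:M + (- q J) *m (normal Q J)^T.
have tipE x : tip J x = B *m x + q J.
  rewrite /B mulmxDl mul1mx -mulmxA -addrA; congr (_ + _).
  rewrite [(normal Q J)^T *m x]mx11_scalar -/(dotv _ _) mul_mx_scalar scalerN.
  by rewrite scalerBl scale1r addrC.
have dB : \det B = - t.
  rewrite det_rank_one -/(dotv _ _) dotvN q_eq //; ring.
have uB : B \in unitmx by rewrite unitmxE dB unitfE oppr_eq0 gt_eqF.
have [_ [f0 fJ]] := sF Js.
have mJ := mble_hull0 fJ.
rewrite -(vol_diff_null mJ null_N).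
have -> : [set tip J x | x in hull0 Q J `\` N] = [set B *m x + q J | x in hull0 Q J `\` N].
  by congr image; apply/funext => x; exact: tipE.
have := vol_affine (q J) uB (mbleD mJ (proj1 null_N)).
by rewrite dB normrN gtr0_norm.
Qed.

Lemma push_out f0 (K : set 'cV[R]_k) : bmx Q f0 \in unitmx ->
    mble K -> hull0 Q [set: 'I_m]%SET `<=` K ->
    (forall J x, J \in s -> hull0 Q J x -> K (tip J x)) ->
  (vol (hull0 Q [set: 'I_m]%SET) + t%:E * \sum_(J <- s) vol (hull0 Q J) <= vol K)%E.
Proof.
move=> uf0 mK PK tipK.
have b0 : basis_in Q [set: 'I_m]%SET f0 by split=> // i; rewrite inE.
rewrite (vol_diff (mble_hull0 b0) mK PK) leeD2l //.
rewrite ge0_sume_distrr; last by move=> J _; exact: vol_ge0.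
rewrite big_seq (eq_bigr (fun J => vol [set tip J x | x in hull0 Q J `\` N])); last first.
  by move=> J Js; have [_ ->] := vol_tip Js.
rewrite -big_seq; apply: vol_sum_le => //.
- exact: mbleD mK (mble_hull0 b0).
- move=> J Js; have [mI _] := vol_tip Js; split=> // _ [x [Jx nNx] <-]; split.
    exact: tipK.
  (* At [tip J x] the normal of [J] is [1 + t * (1 - dotv (normal Q J) x)], which exceeds 1, so that
     the image lies outside the hull, unless [x] is on the facet. *)
  move=> /(hull0_dotv (proj1 (facet_normalP (sF Js)))); rewrite dotv_tipJ // gerDl.
  rewrite pmulr_rle0 // subr_le0 => ge1; apply: nNx; right; exists J => //=.
  by apply/eqP; rewrite eq_le ge1 andbT; have [] := hull0_normal (sF Js) (sF Js) Jx.
- move=> J J' Js J's JJ'; apply/seteqP; split => // y [[x [Jx _] <-] [x' [Jx' nNx'] E]].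
  have [_ ax1 ax'x] := hull0_normal (sF Js) (sF J's) Jx.
  have [_ a'x'1 ax'] := hull0_normal (sF J's) (sF Js) Jx'.
  apply: nNx'; left; exists (J, J'); rewrite /= ?Js ?J's //.
  have E1 := congr1 (dotv (normal Q J)) E.
  have E2 := congr1 (dotv (normal Q J')) E.
  rewrite dotv_tipJ // dotv_tip in E1; rewrite dotv_tipJ // dotv_tip in E2.
  have qle := q_le Js J's; have qle' := q_le J's Js.
  rewrite dotvBl.
  set u := dotv (normal Q J) x in E1 E2 ax1 ax'x.
  set u' := dotv (normal Q J') x' in E1 E2 a'x'1 ax' *.
  set w := dotv (normal Q J) x' in E1 ax' *.
  set w' := dotv (normal Q J') x in E2 ax'x.
  have l1 : (1 - u') * dotv (normal Q J) (q J') <= (1 - u') * (1 + t).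
    by rewrite ler_wpM2l // subr_ge0.
  have l2 : (1 - u) * dotv (normal Q J') (q J) <= (1 - u) * (1 + t).
    by rewrite ler_wpM2l // subr_ge0.
  (* Since [w <= u'], [E1] and [l1] give [t * (1 - u) <= t * (1 - u')]; by symmetry [u = u'], and
     then [E1] forces [w = u']. *)
  have tu : t * u = t * u' by apply/eqP; rewrite eq_le; apply/andP; split; nra.
  nra.
Qed.

End PushOut.

Lemma ex_basis_of (R : realType) k m (Q : 'M[R]_(k, m)) :
  \rank Q = k -> exists f : {ffun 'I_k -> 'I_m}, bmx Q f \in unitmx.
Proof.
move=> rQ; have fT : row_full Q^T by rewrite /row_full mxrank_tr rQ.
exists (fullrankfun fT).
rewrite -unitmx_tr -row_full_unit.
rewrite (_ : (bmx Q (fullrankfun fT))^T = rowsub (fullrankfun fT) Q^T).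
  exact: fullrowsub_full.
by apply/matrixP => i j; rewrite !mxE.
Qed.

(** * Facets as point sets and as index sets *)

Section FacetGeometry.
Variables (R : realType) (k m : nat) (Q : 'M[R]_(k, m)).
Implicit Types (f : {ffun 'I_k -> 'I_m}) (J : {set 'I_m}).
Notation P := (hull0 Q [set: 'I_m]%SET).

Lemma conv_hull0 J (A : set 'cV[R]_k) : A `<=` hull0 Q J -> Defs.conv A `<=` hull0 Q J.
Proof.
move=> AJ _ [l [w [p [pA [w0 [w1 ->]]]]]].
have /choice[c cP] : forall i, exists c : 'cV[R]_m,
    [/\ pos c, (forall j, j \notin J -> c j 0 = 0), csum c <= 1 & p i = Q *m c].
  by move=> i; exact: AJ (pA i).
exists (\sum_i w i *: c i); split.
- by move=> j; rewrite summxE sumr_ge0 // => i _; have [c0 _ _ _] := cP i; rewrite mxE mulr_ge0.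
- move=> j jJ; rewrite summxE big1 // => i _; have [_ cJ _ _] := cP i.
  by rewrite mxE cJ // mulr0.
- rewrite /csum; under eq_bigr do rewrite summxE.
  rewrite exchange_big -w1 /=; apply: ler_sum => i _.
  have [_ _ c1 _] := cP i; under eq_bigr do rewrite mxE.
  by rewrite -mulr_sumr ler_piMr.
- rewrite mulmx_sumr; apply: eq_bigr => i _; have [_ _ _ ->] := cP i.
  by rewrite scalemxAr.
Qed.

Lemma hull0_col J j : j \in J -> hull0 Q J (col j Q).
Proof.
move=> jJ; exists (delta_mx j 0); split; rewrite ?colE //.
- by move=> i; rewrite mxE ler0n.
- by move=> i iJ; rewrite mxE; case: eqP => // ij; rewrite ij jJ in iJ.
- rewrite /csum (bigD1 j) //= mxE !eqxx big1 ?addr0 // => i ij.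
  by rewrite mxE (negbTE ij).
Qed.

Lemma valid_normal J a f : valid Q J a -> basis_in Q J f -> a = normal Q J.
Proof.
move=> va fb; have [fJ uf] := fb.
have FJ : facet_set Q J by split; [exists a|exists f].
have [vn1 vn] := facet_normalP FJ.
have [va1 va2] := va.
apply: trmx_inj; rewrite -[LHS](mulmxK uf) -[RHS](mulmxK uf); congr (_ *m _).
apply/matrixP => z i; rewrite (ord1 z).
have E (b : 'cV[R]_k) : (b^T *m bmx Q f) 0 i = dotv b (col (f i) Q).
  by rewrite /dotv !mxE; apply: eq_bigr => l _; rewrite !mxE.
by rewrite !E; move: (fJ i) (fJ i); rewrite {1}va2 vn => /eqP -> /eqP ->.
Qed.

(** Complementary slackness: a weighted sum of values at most 1, with total weight at most 1,
    reaches 1 only if all the weight sits where the value is 1. *)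
Lemma tight_hull0 J a (c : 'cV[R]_m) : valid Q J a -> pos c -> csum c <= 1 ->
  dotv a (Q *m c) = 1 -> csum c = 1 /\ forall j, j \notin J -> c j 0 = 0.
Proof.
move=> [a1 aJ] c0 c1; rewrite dotv_mulmx => E.
have le j : c j 0 * dotv a (col j Q) <= c j 0 by rewrite ler_piMr.
have S1 : csum c = 1.
  by apply/eqP; rewrite eq_le c1 -E; apply: ler_sum => j _; exact: le.
split=> // j jJ.
have D0 : \sum_j (c j 0 - c j 0 * dotv a (col j Q)) = 0.
  by rewrite sumrB E -/(csum c) S1 subrr.
have F0 l : true -> 0 <= c l 0 - c l 0 * dotv a (col l Q) by rewrite subr_ge0.
have Fj : c j 0 - c j 0 * dotv a (col j Q) = 0 by exact: (psumr_eq0P F0 D0).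
move: Fj => /eqP.
rewrite -[X in X - _]mulr1 -mulrBr mulf_eq0 subr_eq0 [1 == _]eq_sym => /orP[/eqP //|].
by rewrite -aJ (negbTE jJ).
Qed.

Definition face J : set 'cV[R]_k := P `&` [set x | dotv (normal Q J) x = 1].

Lemma face_hull0 J x : facet_set Q J -> face J x ->
  exists c : 'cV[R]_m, [/\ pos c, forall j, j \notin J -> c j 0 = 0, csum c = 1 & x = Q *m c].
Proof.
move=> FJ [[c [c0 _ c1 ->]] /= n1].
by have [S cJ] := tight_hull0 (facet_normalP FJ) c0 c1 n1; exists c.
Qed.

Lemma face_col J j : facet_set Q J -> face J (col j Q) <-> j \in J.
Proof.
move=> /facet_normalP[n1 ->]; split; first by move=> [_ /eqP].
by move=> /eqP E; split=> //; apply: hull0_col; rewrite inE.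
Qed.

Lemma conv_face J : facet_set Q J -> Defs.conv (face J `|` [set 0]) = hull0 Q J.
Proof.
move=> FJ; apply/seteqP; split.
  apply: conv_hull0 => x [Fx|->].
    by have [c [c0 cJ c1 ->]] := face_hull0 FJ Fx; exists c; rewrite c1.
  exists 0; split=> [i|j _||]; rewrite ?mulmx0 ?mxE //.
  by rewrite /csum big1 ?ler01 // => i _; rewrite mxE.
move=> x [c [c0 cJ c1 ->]].
(* The extra index puts the missing weight on the apex 0; columns outside [J], which have weight 0,
   are replaced by 0 so that every point lies in the set. *)
pose w (i : 'I_(1 + m)) := match fintype.split i with inl _ => 1 - csum c | inr j => c j 0 end.
pose p (i : 'I_(1 + m)) : 'cV[R]_k := match fintype.split i with inl _ => 0 
  | inr j => if j \in J then col j Q else 0 end.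
exists (1 + m)%N, w, p; split.
  move=> i; rewrite /p; case: fintype.split => j; first by right.
  by case: ifPn => jJ; [left; apply/face_col|right].
split; first by move=> i; rewrite /w; case: fintype.split => j //; rewrite subr_ge0.
have sl (j : 'I_1) : fintype.split (lshift m j) = inl j by exact: (unsplitK (inl j)).
have sr (j : 'I_m) : fintype.split (rshift 1 j) = inr j by exact: (unsplitK (inr j)).
split.
  rewrite big_split_ord big_ord1 /w sl (eq_bigr (fun j => c j 0)); last by move=> j _; rewrite sr.
  by rewrite /= -/(csum c) subrK.
rewrite big_split_ord big_ord1 /w /p sl /= scaler0 add0r mulmx_col.
apply: eq_bigr => j _; rewrite sr /=; case: ifPn => // /cJ ->.
by rewrite !scale0r.
Qed.

Lemma facet_face J : (0 < k)%N -> facet_set Q J -> facet P (face J).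
Proof.
move=> k0 FJ; have [n1 nJ] := facet_normalP FJ; have [_ [f [fJ uf]]] := FJ.
exists (normal Q J), 1; split.
  apply/eqP => n0; have := nJ (f (Ordinal k0)).
  by rewrite fJ n0 /dotv trmx0 mul0mx mxE eq_sym oner_eq0.
split; first by move=> x; exact: hull0_dotv.
split=> //; exists (fun i => col (f i) Q); split.
  by move=> i; apply/face_col.
move=> c _ E i; pose u : 'cV[R]_k := \col_i c i.
have : bmx Q f *m u = 0.
  rewrite mulmx_col -[RHS]E; apply: eq_bigr => l _; rewrite mxE; congr (_ *: _).
  by apply/matrixP => a b; rewrite !mxE.
move=> /(congr1 (mulmx (invmx (bmx Q f)))); rewrite mulKmx // mulmx0.
by move=> /matrixP/(_ i 0); rewrite !mxE.
Qed.

Lemma face_facet (F : set 'cV[R]_k) a : (forall j, dotv a (col j Q) <= 1) ->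
    F = P `&` [set x | dotv a x = 1] ->
    (exists w : 'I_k -> 'cV[R]_k, (forall i, F (w i)) /\ aff_indep w) ->
  exists J, facet_set Q J /\ F = face J.
Proof.
move=> a1 FE [w [wF wI]]; pose J := finset (fun j => dotv a (col j Q) == 1).
have va : valid Q J a by split=> // j; rewrite inE.
suff [f fb] : exists f, basis_in Q J f.
  exists J; split; first by split; [exists a|exists f].
  by rewrite FE /face -(valid_normal va fb).
have /choice[c cP] : forall i, exists c : 'cV[R]_m,
    (forall j, j \notin J -> c j 0 = 0) /\ w i = Q *m c.
  move=> i; have := wF i; rewrite FE => -[[c [c0 _ c1 wc]] /= aw].
  rewrite wc in aw; have [_ cJ] := tight_hull0 va c0 c1 aw.
  by exists c.
(* The points [w] are combinations of the columns in [J], so [QJ] still has rank [k], and a basis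
   chosen among its columns can only use indices in [J]. *)
pose QJ : 'M[R]_(k, m) := \matrix_(i, j) (if j \in J then Q i j else 0).
have wE : (\matrix_(a, i) w i a 0) = QJ *m (\matrix_(j, i) c i j 0).
  apply/matrixP => b i; rewrite mxE; have [cJ ->] := cP i; rewrite !mxE.
  apply: eq_bigr => j _; rewrite !mxE; case: ifPn => // /cJ ->.
  by rewrite !mulr0.
(* Affine independence becomes linear: [a] is 1 at every [w i], so the coefficients of a linear
   relation sum to 0. *)
have uW : (\matrix_(a, i) w i a 0) \in unitmx.
  rewrite -unitmx_tr -row_free_unit -kermx_eq0; apply/eqP/row_matrixP => z.
  rewrite row0; set u := row z _.
  have uW : u *m (\matrix_(a, i) w i a 0)^T = 0.
    by rewrite /u -row_mul mulmx_ker row0.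
  clearbody u.
  have uw : \sum_i u 0 i *: w i = 0.
    apply/matrixP => b b'; rewrite (ord1 b') summxE mxE.
    move/matrixP/(_ 0 b): uW; rewrite !mxE => uW; rewrite -[RHS]uW.
    by apply: eq_bigr => i _; rewrite !mxE.
  apply/matrixP => b i; rewrite (ord1 b) [RHS]mxE; apply: (wI (fun i => u 0 i)) => //.
  transitivity (\sum_i dotv a (u 0 i *: w i)); last by rewrite -dotv_sum uw dotv0.
  apply: eq_bigr => l _; have := wF l; rewrite FE dotvZ => -[_ /= ->].
  by rewrite mulr1.
have rQJ : \rank QJ = k.
  apply/eqP; rewrite eqn_leq rank_leq_row /=.
  by rewrite -{1}(mxrank_unit uW) wE mxrankM_maxl.
have [f uf] := ex_basis_of rQJ.
have fJ i : f i \in J.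
  apply: contraLR uf => fiJ; rewrite unitmxE (expand_det_col _ i) big1 ?unitr0 // => l _.
  by rewrite !mxE (negbTE fiJ) mul0r.
exists f; split=> //; rewrite (_ : bmx Q f = bmx QJ f) //.
by apply/matrixP => b i; rewrite !mxE fJ.
Qed.


End FacetGeometry.

Section Simplex.
Variables (R : realType) (k m : nat) (Q : 'M[R]_(k, m)).

Lemma basis_injective f : bmx Q f \in unitmx -> injective f.
Proof.
move=> uf i j fij; have : bmx Q f *m (delta_mx i 0 - delta_mx j 0 : 'cV_k) = 0.
  by rewrite mulmxBr -!colE; apply/matrixP => a b; rewrite !mxE fij subrr.
move=> /(congr1 (mulmx (invmx (bmx Q f)))); rewrite mulKmx // mulmx0.
move=> /matrixP/(_ i 0) /eqP; rewrite !mxE !eqxx andbT.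
by case: (eqVneq i j) => //= _; rewrite subr0 oner_eq0.
Qed.

Lemma card_facet_set J : facet_set Q J -> (k <= #|J|)%N.
Proof.
move=> [_ [f [fJ uf]]]; rewrite -[X in (X <= _)%N](card_ord k).
rewrite -(card_imset _ (basis_injective uf)); apply: subset_leq_card.
by apply/fintype.subsetP => _ /imsetP[i _ ->].
Qed.

Lemma face_simplex J : facet_set Q J -> #|J| = k ->
  exists w : 'I_k -> 'cV[R]_k, aff_indep w /\ face Q J = Defs.conv (range w).
Proof.
move=> FJ cJ; have [_ [f [fJ uf]]] := FJ.
have fI := basis_injective uf.
have JE : [set f i | i in 'I_k]%SET = J.
  apply/eqP; rewrite eqEcard cJ card_imset // card_ord leqnn andbT.
  by apply/fintype.subsetP => _ /imsetP[i _ ->].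
exists (fun i => col (f i) Q); split.
  move=> c _ E i; pose u : 'cV[R]_k := \col_i c i.
  have : bmx Q f *m u = 0.
    rewrite mulmx_col -[RHS]E; apply: eq_bigr => l _; rewrite mxE; congr (_ *: _).
    by apply/matrixP => a b; rewrite !mxE.
  move=> /(congr1 (mulmx (invmx (bmx Q f)))); rewrite mulKmx // mulmx0.
  by move=> /matrixP/(_ i 0); rewrite !mxE.
have sumJ (V : zmodType) (F : 'I_m -> V) : (forall j, j \notin J -> F j = 0) ->
    \sum_j F j = \sum_(i < k) F (f i).
  move=> F0; rewrite (bigID (mem J)) /= [X in _ + X]big1 ?addr0 //.
  by rewrite -JE big_imset //= => i j _ _; exact: fI.
apply/seteqP; split.
  move=> x /(face_hull0 FJ)[c [c0 c0J c1 ->]].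
  exists k, (fun i => c (f i) 0), (fun i => col (f i) Q); split.
    by move=> i; exists i.
  split; first by move=> i; exact: c0.
  split; first by rewrite -c1 /csum (sumJ _ (fun j => c j 0)).
  by rewrite mulmx_col (sumJ _ (fun j => c j 0 *: col j Q)) // => j /c0J ->; rewrite scale0r.
move=> x [l [w [p [pA [w0 [w1 xE]]]]]].
have pF i : face Q J (p i).
  by have [j _ <-] := pA i; apply/face_col.
split.
  apply: (@conv_hull0 _ _ _ Q _ (face Q J)); first by move=> y [].
  by exists l, w, p.
rewrite /= xE dotv_sum -w1; apply: eq_bigr => i _.
by rewrite dotvZ; have [_ /= ->] := pF i; rewrite mulr1.
Qed.

End Simplex.

(** * The symmetric hull of a frame *)

Section SymHull.
Variables (R : realType) (k n : nat) (S : 'M[R]_(k, n)).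
Implicit Types (J : {set 'I_(n + n)}).

Definition sym : 'M[R]_(k, n + n) := row_mx S (- S).

Lemma col_symL i : col (lshift n i) sym = col i S.
Proof. exact: colKl. Qed.

Lemma col_symR i : col (rshift n i) sym = - col i S.
Proof. by rewrite /sym colKr; apply/matrixP => a b; rewrite !mxE. Qed.

Lemma symhullE : (0 < n)%N -> symhull S = hull0 sym [set: 'I_(n + n)]%SET.
Proof.
move=> n0; apply/seteqP; split.
  apply: conv_hull0 => x [i [->|->]].
    by rewrite -col_symL; apply: hull0_col; rewrite inE.
  by rewrite -col_symR; apply: hull0_col; rewrite inE.
move=> x [c [c0 _ c1 ->]]; pose i0 := Ordinal n0; pose r := (1 - csum c) / 2.
(* The missing weight is shared equally by a column and its opposite, whose contributions cancel. *)
pose c' : 'cV[R]_(n + n) := c + r *: (delta_mx (lshift n i0) 0 + delta_mx (rshift n i0) 0).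
have r0 : 0 <= r by rewrite divr_ge0 // subr_ge0.
exists (n + n)%N, (fun j => c' j 0), (fun j => col j sym); split.
  move=> j; have [i|i] := fintype.splitP j => ij.
    by exists i; left; rewrite -col_symL; congr (col _ _); apply/val_inj.
  by exists i; right; rewrite -col_symR; congr (col _ _); apply/val_inj.
split.
  move=> j; rewrite !mxE; apply: addr_ge0; first exact: c0.
  by rewrite mulr_ge0 // addr_ge0 // ler0n.
split.
  have d1 l : csum (delta_mx l 0 : 'cV[R]_(n + n)) = 1.
    rewrite /csum (bigD1 l) //= mxE !eqxx big1 ?addr0 // => i il.
    by rewrite mxE (negbTE il).
  by rewrite -/(csum c') csumD csumZ csumD !d1 /r; field.
rewrite -mulmx_col /c' mulmxDr -scalemxAr mulmxDr -!colE col_symL col_symR.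
by rewrite subrr scaler0 addr0.
Qed.

Lemma dotv_sym a i : dotv a (col (rshift n i) sym) = - dotv a (col (lshift n i) sym).
Proof. by rewrite col_symL col_symR dotvN. Qed.

Lemma facet_set_anti J i : facet_set sym J -> lshift n i \in J -> rshift n i \notin J.
Proof.
move=> /facet_normalP[_ nJ]; rewrite !nJ dotv_sym => /eqP ->.
by rewrite eqNr oner_eq0.
Qed.

(* The uframe equation makes 0 an interior point, so that facets do not contain it. *)
Lemma facet_symhull F : (0 < n)%N -> S *m S^T = 1%:M -> facet (symhull S) F ->
  exists J, facet_set sym J /\ F = face sym J.
Proof.
move=> n0 SS [a [b [a0 [aP [FE wF]]]]].
have leb i : `|dotv a (col i S)| <= b.
  rewrite ler_norml lerNl -dotvN; apply/andP; split; apply: aP;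
    rewrite symhullE // -?col_symR -?col_symL; apply: hull0_col; by rewrite inE.
have b0 : 0 < b.
  rewrite lt_neqAle (le_trans _ (leb (Ordinal n0))) // andbT eq_sym.
  (* If [b = 0], then [a] is orthogonal to every column, and [a^T = a^T *m S *m S^T] vanishes. *)
  apply: contra a0 => /eqP b0; rewrite -trmx_eq0 -[a^T]mulmx1 -SS mulmxA.
  suff -> : a^T *m S = 0 by rewrite mul0mx.
  apply/matrixP => z i; rewrite (ord1 z) [RHS]mxE.
  have := leb i; rewrite b0 normr_le0 => /eqP <-.
  by rewrite /dotv !mxE; apply: eq_bigr => l _; rewrite !mxE.
apply: (@face_facet _ _ _ sym F (b^-1 *: a)) => //.
  move=> j; rewrite /dotv linearZ /= -scalemxAl mxE -/(dotv _ _) mulrC ler_pdivrMr // mul1r.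
  by apply: aP; rewrite symhullE //; apply: hull0_col; rewrite inE.
rewrite FE symhullE //; congr (_ `&` _); apply/seteqP; split => x /=;
  rewrite [dotv (_ *: _) _]/dotv linearZ /= -scalemxAl mxE -/(dotv _ _).
  by move=> ->; rewrite mulVf // gt_eqF.
by move=> E; rewrite -[RHS]mulr1 -E mulrA mulfV ?mul1r // gt_eqF.
Qed.

Definition star_facets (i : 'I_n) : seq {set 'I_(n + n)} :=
  [seq J <- enum {set 'I_(n + n)} | `[< facet_set sym J >] &&
    ((lshift n i \in J) || (rshift n i \in J))].

Lemma mem_star_facets i J : (J \in star_facets i) =
  `[< facet_set sym J >] && ((lshift n i \in J) || (rshift n i \in J)).
Proof. by rewrite mem_filter mem_enum andbT. Qed.

Lemma star_symhull i : (0 < k)%N -> (0 < n)%N -> S *m S^T = 1%:M ->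
  star (symhull S) (col i S) = \bigcup_(J in [set` star_facets i]) hull0 sym J.
Proof.
move=> k0 n0 SS; apply/seteqP; split => x.
  move=> [F [/(facet_symhull n0 SS)[J [FJ ->]] [vF Fx]]]; exists J; last by rewrite -conv_face.
  rewrite /= mem_star_facets; apply/andP; split; first exact/asboolP.
  by move: vF; rewrite -col_symR -col_symL; case=> /face_col -> //; rewrite orbT.
move=> [J]; rewrite /= mem_star_facets => /andP[/asboolP FJ iJ] Jx.
exists (face sym J); split; first by rewrite symhullE //; exact: facet_face.
split; last by rewrite conv_face.
by case/orP: iJ => iJ; [left; rewrite -col_symL|right; rewrite -col_symR]; apply/face_col.
Qed.

(** Otherwise [v] would be an average of points at which [a] is strictly smaller than at [v]. *)
Lemma vertex_symhull v : vertex (symhull S) v -> exists i, v = col i S \/ v = - col i S.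
Proof.
move=> [[l [w [p [pA [w0 [w1 vE]]]]]] [a av]].
have [[i piv]|nv] := pselect (exists i, p i = v).
  by have [j pj] := pA i; exists j; rewrite -piv.
have lt i : dotv a (p i) < dotv a v.
  apply: av; last by move=> pv; apply: nv; exists i.
  exists 1%N, (fun=> 1), (fun=> p i); split; first by [].
  by rewrite !big_ord1 scale1r.
have D0 : \sum_i w i * (dotv a v - dotv a (p i)) = 0.
  under eq_bigr do rewrite mulrBr.
  rewrite sumrB -mulr_suml w1 mul1r {1}vE dotv_sum.
  by rewrite (eq_bigr (fun i => w i * dotv a (p i))) ?subrr // => i _; rewrite dotvZ.
have F0 i : true -> 0 <= w i * (dotv a v - dotv a (p i)).
  by move=> _; rewrite mulr_ge0 // subr_ge0 ltW.
have wz i : w i = 0.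
  have : w i * (dotv a v - dotv a (p i)) = 0 by exact: (psumr_eq0P F0 D0).
  by move=> /eqP; rewrite mulf_eq0 subr_eq0 (gt_eqF (lt i)) orbF => /eqP.
by move: w1; rewrite big1 => [/eqP|i _]; [rewrite eq_sym oner_eq0|exact: wz].
Qed.

End SymHull.

(** * Linear images and the stretching of one column *)

Section Linear.
Variables (R : realType) (k : nat).

Lemma hull0_mulmx m (B : 'M[R]_k) (Q : 'M[R]_(k, m)) J :
  hull0 (B *m Q) J = [set B *m x + 0 | x in hull0 Q J].
Proof.
apply/seteqP; split => x.
  move=> [c [c0 cJ c1 ->]]; exists (Q *m c); last by rewrite addr0 mulmxA.
  by exists c.
by move=> [_ [c [c0 cJ c1 ->]] <-]; exists c; rewrite addr0 mulmxA.
Qed.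

Lemma sym_mulmx n (B : 'M[R]_k) (S : 'M[R]_(k, n)) : sym (B *m S) = B *m sym S.
Proof. by rewrite /sym mul_mx_row mulmxN. Qed.

Lemma rank_sym n (S : 'M[R]_(k, n)) : S *m S^T \in unitmx -> \rank (sym S) = k.
Proof.
move=> uS; apply/eqP; rewrite eqn_leq rank_leq_row /=.
have SE : S = sym S *m col_mx 1%:M 0.
  by rewrite /sym mul_row_col mulmx1 mulmx0 addr0.
rewrite -{1}(mxrank_unit uS) {1}SE -mulmxA; exact: mxrankM_maxl.
Qed.

Lemma rank_one_mul (v : 'cV[R]_k) (x y : R) :
  (1%:M + x *: (v *m v^T)) *m (1%:M + y *: (v *m v^T)) =
  1%:M + (x + y + x * y * sqnorm v) *: (v *m v^T).
Proof.
have VV : (v *m v^T) *m (v *m v^T) = sqnorm v *: (v *m v^T).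
  rewrite mulmxA -(mulmxA v) [v^T *m v]mx11_scalar -/(dotv v v) -/(sqnorm v).
  by rewrite mul_mx_scalar scalemxAl.
rewrite mulmxDl mul1mx mulmxDr mulmx1 -scalemxAl -scalemxAr VV !scalerA.
by rewrite !scalerDl !addrA [_ + y *: _ + _]addrAC.
Qed.

Lemma det_rank_one_sym (v : 'cV[R]_k) (x : R) :
  \det (1%:M + x *: (v *m v^T)) = 1 + x * sqnorm v.
Proof. by rewrite scalemxAl det_rank_one -/(dotv _ _) dotvZ. Qed.

Lemma sqnorm_ge0 (v : 'cV[R]_k) : 0 <= sqnorm v.
Proof. by rewrite /sqnorm /dotv mxE sumr_ge0 // => i _; rewrite mxE -expr2 sqr_ge0. Qed.

Definition stretch n (S : 'M[R]_(k, n)) (i : 'I_n) (t : R) : 'M[R]_(k, n) :=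
  S + t *: (col i S *m delta_mx 0 i).

Lemma col_stretch n (S : 'M[R]_(k, n)) i t j :
  col j (stretch S i t) = (if j == i then 1 + t else 1) *: col j S.
Proof.
apply/matrixP => a b; rewrite !mxE big_ord1 !mxE eqxx /=.
by case: eqP => [->|_]; rewrite ?mulr1 ?mulr0 ?mul1r ?addr0 // mulrDl mul1r.
Qed.

(** Only the summand of column [i] changes, by the factor [(1 + t) ^+ 2]. *)
Lemma stretch_gram n (S : 'M[R]_(k, n)) i t : S *m S^T = 1%:M ->
  stretch S i t *m (stretch S i t)^T =
  1%:M + (2 * t + t ^+ 2) *: (col i S *m (col i S)^T).
Proof.
move=> SS; set v := col i S; set e : 'rV[R]_n := delta_mx 0 i.
have eS : e *m S^T = v^T by rewrite -rowE tr_col.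
have Se : S *m e^T = v by rewrite /e trmx_delta -colE.
have ee : e *m e^T = 1%:M.
  by rewrite /e trmx_delta mul_delta_mx; apply/matrixP => a b; rewrite !ord1 !mxE eqxx.
have TT : (stretch S i t)^T = S^T + t *: (e^T *m v^T).
  by rewrite -trmx_mul /stretch linearD /= linearZ.
rewrite TT /stretch -/v -/e mulmxDl !mulmxDr SS.
rewrite -!scalemxAl -!scalemxAr scalerA mulmxA Se -(mulmxA v e S^T) eS.
rewrite -(mulmxA v e) (mulmxA e) ee mul1mx -!addrA; congr (_ + _).
by rewrite (_ : 2 * t + t ^+ 2 = t + t + t * t); [rewrite !scalerDl addrA|ring].
Qed.

End Linear.

Section StarPush.
Variables (R : realType) (k n : nat) (S : 'M[R]_(k, n)) (i : 'I_n) (t : R).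
Hypotheses (SS : S *m S^T = 1%:M) (t0 : 0 < t).
Notation v := (col i S).
Notation St := (stretch S i t).

Let n0 : (0 < n)%N. Proof. exact: leq_ltn_trans (leq0n i) (ltn_ord i). Qed.

Let sc (j : 'I_(n + n)) : R := if (j == lshift n i) || (j == rshift n i) then 1 + t else 1.

Let sc_ge1 j : 1 <= sc j.
Proof. by rewrite /sc; case: ifP => _ //; rewrite lerDl ltW. Qed.

Let sc_gt0 j : 0 < sc j. Proof. exact: lt_le_trans ltr01 (sc_ge1 j). Qed.

Let col_sc j : col j (sym St) = sc j *: col j (sym S).
Proof.
have [a|a] := fintype.splitP j => ja.
  have -> : j = lshift n a by apply/val_inj.
  by rewrite !col_symL col_stretch /sc !eq_shift orbF.
have -> : j = rshift n a by apply/val_inj.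
by rewrite !col_symR col_stretch /sc !eq_shift scalerN.
Qed.

Let rescale (c : 'cV[R]_(n + n)) : pos c -> exists c' : 'cV[R]_(n + n),
  [/\ pos c', csum c' <= csum c & sym S *m c = sym St *m c'].
Proof.
move=> c0; exists (\col_j (c j 0 / sc j)); split.
- by move=> j; rewrite mxE divr_ge0 // ltW.
- by apply: ler_sum => j _; rewrite mxE ler_pdivrMr // ler_peMr.
- rewrite !mulmx_col; apply: eq_bigr => j _.
  by rewrite mxE col_sc scalerA divfK // gt_eqF.
Qed.

Let unit_gram : St *m St^T \in unitmx.
Proof.
rewrite stretch_gram // unitmxE det_rank_one_sym unitfE gt_eqF //.
rewrite ltr_pwDl // mulr_ge0 ?sqnorm_ge0 // addr_ge0 ?sqr_ge0 // mulr_ge0 // ltW //.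
Qed.

(** The apex for a facet [J] is the stretched copy of whichever of [v] and [- v] lies on [J]. The
    normal of [J] takes the value [1 + t] there; those of the other facets are at most 1 before
    stretching, hence at most [1 + t] after it. *)
Lemma star_push :
  (vol (symhull S) + t%:E * \sum_(J <- star_facets S i) vol (hull0 (sym S) J)
   <= vol (symhull St))%E.
Proof.
rewrite !symhullE //.
have [f0 uf0] : exists f, bmx (sym S) f \in unitmx.
  by apply: ex_basis_of; apply: rank_sym; rewrite SS unitmx1.
have [f1 uf1] := ex_basis_of (rank_sym unit_gram).
pose ix (J : {set 'I_(n + n)}) := if lshift n i \in J then lshift n i else rshift n i.
have ixJ J : J \in star_facets S i -> ix J \in J.
  rewrite mem_star_facets /ix => /andP[_]; by case: ifP.
have sF J : J \in star_facets S i -> facet_set (sym S) J.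
  by rewrite mem_star_facets => /andP[/asboolP].
have ixE J : sc (ix J) = 1 + t by rewrite /sc /ix; case: (lshift n i \in J); rewrite eqxx ?orbT.
apply: (@push_out _ _ _ (sym S) (star_facets S i) (fun J => col (ix J) (sym St)) t _ t0 sF
  _ _ f0) => //.
- by rewrite filter_uniq // enum_uniq.
- move=> J Js; have [_ nJ] := facet_normalP (sF J Js).
  have := ixJ J Js; rewrite nJ => /eqP E.
  by rewrite col_sc ixE dotvZ E mulr1.
- move=> J J' Js J's; have [nJ _] := facet_normalP (sF J Js).
  by rewrite col_sc ixE dotvZ ler_piMr // addr_ge0 // ltW.
- by apply: (@mble_hull0 _ _ _ _ _ f1); split=> // j; rewrite inE.
- move=> x [c [c0 _ c1 ->]]; have [c' [c'0 c'1 ->]] := rescale c0.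
  by exists c'; split=> //; [move=> j; rewrite inE|exact: le_trans c1].
- move=> J x Js [c [c0 cJ c1 xE]].
  have ax : dotv (normal (sym S) J) x = csum c.
    rewrite xE dotv_mulmx; apply: eq_bigr => j _; have [_ nJ] := facet_normalP (sF J Js).
    have [|/cJ ->] := boolP (j \in J); last by rewrite mul0r.
    by rewrite nJ => /eqP ->; rewrite mulr1.
  have [c' [c'0 c'1 c'E]] := rescale c0.
  exists (c' + (1 - csum c) *: delta_mx (ix J) 0); split.
  + move=> j; rewrite !mxE; apply: addr_ge0; first exact: c'0.
    by rewrite mulr_ge0 ?subr_ge0 // ler0n.
  + by move=> j; rewrite inE.
  + rewrite csumD csumZ (_ : csum (delta_mx _ _) = 1); first lra.
    rewrite /csum (bigD1 (ix J)) //= mxE !eqxx big1 ?addr0 // => l li.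
    by rewrite mxE (negbTE li).
  + by rewrite /tip ax mulmxDr -scalemxAr -colE -c'E -xE.
Qed.

End StarPush.

Section VolSymhull.
Variables (R : realType) (k n : nat) (S : 'M[R]_(k, n)).
Hypothesis n0 : (0 < n)%N.

Lemma vol_symhull_mulmx (B : 'M[R]_k) : B \in unitmx -> S *m S^T \in unitmx ->
  vol (symhull (B *m S)) = (`|\det B|%:E * vol (symhull S))%E.
Proof.
move=> uB /rank_sym/ex_basis_of[f uf].
have b : basis_in (sym S) [set: 'I_(n + n)]%SET f by split=> // i; rewrite inE.
rewrite !symhullE // sym_mulmx hull0_mulmx.
by have [_ ->] := vol_affine 0 uB (mble_hull0 b).
Qed.

End VolSymhull.

(** For [S *m S^T = 1%:M], the square root of the determinant of the Gram matrix of
    [stretch S i t]. *)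
Definition gram_norm (R : realType) k n (S : 'M[R]_(k, n)) i (t : R) : R :=
  Num.sqrt (1 + (2 * t + t ^+ 2) * sqnorm (col i S)).

(* The inverse square root of the Gram matrix of [stretch S i t], in a form that
   stays meaningful when column [i] is 0. *)
Definition gram_inv_sqrt (R : realType) k n (S : 'M[R]_(k, n)) i (t : R) : 'M[R]_k :=
  1%:M + (- (2 * t + t ^+ 2) / (gram_norm S i t * (1 + gram_norm S i t))) *:
    (col i S *m (col i S)^T).

(** * First-order consequence of local maximality *)

Section Renormalise.
Variables (R : realType) (k n : nat) (S : 'M[R]_(k, n)) (i : 'I_n) (t : R).
Hypotheses (SS : S *m S^T = 1%:M) (t0 : 0 < t) (t1 : t <= 1).
Notation v := (col i S).
Notation St := (stretch S i t).
Notation r := (sqnorm v).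
Notation s := (gram_norm S i t).
Notation beta := (- (2 * t + t ^+ 2) / (s * (1 + s))).
Notation B := (gram_inv_sqrt S i t).

Let n0 : (0 < n)%N. Proof. exact: leq_ltn_trans (leq0n i) (ltn_ord i). Qed.
Let r0 : 0 <= r. Proof. exact: sqnorm_ge0. Qed.
Let tt0 : 0 <= 2 * t + t ^+ 2.
Proof. by rewrite addr_ge0 ?sqr_ge0 // mulr_ge0 // ltW. Qed.

Let s2 : s ^+ 2 = 1 + (2 * t + t ^+ 2) * r.
Proof. by rewrite sqr_sqrtr // addr_ge0 // mulr_ge0. Qed.

Let s1 : 1 <= s.
Proof.
rewrite -[X in X <= _]sqrtr1 ler_sqrt; first by rewrite lerDl mulr_ge0.
by rewrite addr_ge0 // mulr_ge0.
Qed.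

Let s0 : 0 < s. Proof. exact: lt_le_trans s1. Qed.

Let betaE : beta * (s * (1 + s)) = - (2 * t + t ^+ 2).
Proof. by rewrite divfK // mulf_neq0 // gt_eqF // addr_gt0. Qed.

(** For nonzero [v] this is the eigenvalue of [B] at [v], where the Gram matrix has the eigenvalue
    [s ^+ 2]. Solving for [beta] gives [(1 - s) / (s * r)]; multiplying above and below by [1 + s]
    removes [r] from the denominator. *)
Let beta_r : 1 + beta * r = s^-1.
Proof.
have sn : s != 0 by rewrite gt_eqF.
have sn1 : 1 + s != 0 by rewrite gt_eqF // addr_gt0.
have E : (2 * t + t ^+ 2) * r = s ^+ 2 - 1 by rewrite s2 addrAC subrr add0r.
have -> : beta * r = (1 - s ^+ 2) / (s * (1 + s)).
  by rewrite mulrAC mulNr E opprB.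
by field; rewrite sn sn1.
Qed.

Let detB : \det B = s^-1.
Proof. by rewrite det_rank_one_sym beta_r. Qed.

Let BAB : B *m (1%:M + (2 * t + t ^+ 2) *: (v *m v^T)) *m B^T = 1%:M.
Proof.
have BT : B^T = B.
  by rewrite /gram_inv_sqrt linearD /= linearZ /= trmx_mul trmxK trmx1.
rewrite BT /gram_inv_sqrt; have := beta_r; have := betaE; set b := beta => bE br.
rewrite !rank_one_mul -[RHS]addr0; congr (_ + _).
set c := 2 * t + t ^+ 2; set z := _ + _ + _.
suff -> : z = 0 by rewrite scale0r.
have {}br : b * r = s^-1 - 1 by rewrite -br addrAC subrr add0r.
have -> : z = b * (1 + (s^-1 - 1) + 1) + c * (1 + (s^-1 - 1)) ^+ 2.
  by rewrite -br /z; ring.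
have -> : c = - (b * (s * (1 + s))) by rewrite bE opprK.
by field; rewrite gt_eqF.
Qed.

Let uB : B \in unitmx.
Proof. by rewrite unitmxE detB unitfE invr_eq0 gt_eqF. Qed.

Lemma uframe_renormalised : uframe (B *m St).
Proof.
have E : (B *m St) *m (B *m St)^T = 1%:M.
  by rewrite trmx_mul mulmxA -(mulmxA B) stretch_gram // BAB.
split=> //; apply/eqP; rewrite eqn_leq rank_leq_row /=.
by rewrite -{1}(mxrank1 R k) -E mxrankM_maxl.
Qed.

Lemma vol_stretch : vol (symhull St) = (s%:E * Fvol (B *m St))%E.
Proof.
rewrite /Fvol vol_symhull_mulmx //; last first.
  rewrite stretch_gram // unitmxE det_rank_one_sym unitfE gt_eqF //.
  by rewrite ltr_pwDl // mulr_ge0.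
by rewrite detB normfV gtr0_norm // muleA -EFinM mulfV ?mul1e // gt_eqF.
Qed.

(** A bound free of [t]; its weights 2 and 1 come from [|beta| <= 2 * t] and [|t / s| <= t]. *)
Definition dist_bound : R :=
  \sum_a \sum_b (2 * `|(v *m v^T *m S) a b| + `|(v *m delta_mx 0 i : 'M[R]_(k, n)) a b|) ^+ 2.

Lemma dist_renormalised : mxdist2 S (B *m St) <= t ^+ 2 * dist_bound.
Proof.
have E : B *m St = S + (beta *: (v *m v^T *m S) + (t * s^-1) *: (v *m delta_mx 0 i)).
  rewrite /gram_inv_sqrt /stretch mulmxDl mul1mx mulmxDr -!scalemxAl -!scalemxAr.
  have -> : v *m v^T *m (v *m delta_mx 0 i) = r *: (v *m delta_mx 0 i : 'M[R]_(k, n)).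
    rewrite !mulmxA -(mulmxA v) [v^T *m v]mx11_scalar -/(dotv v v) -/(sqnorm v).
    by rewrite mul_mx_scalar scalemxAl.
  have := beta_r; set b := beta => br; clearbody b.
  rewrite -br scalerA mulrDr mulr1 scalerDl -!addrA; congr (_ + _).
  rewrite addrCA; congr (_ + (_ + _)); rewrite scalerA; congr (_ *: _); ring.
have bt : `|beta| <= 2 * t.
  rewrite normrM normrN normfV ger0_norm // ger0_norm; last by rewrite mulr_ge0 ?addr_ge0 // ltW.
  rewrite ler_pdivrMr; last by rewrite mulr_gt0 // addr_gt0.
  have : 2 <= s * (1 + s) by have := s1; nra.
  have := t0; have := t1; nra.
have st : `|t * s^-1| <= t.
  rewrite ger0_norm; last by rewrite mulr_ge0 ?invr_ge0 // ltW.
  by rewrite ler_piMr ?(ltW t0) // invf_le1.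
move: E bt st; set b := beta; set u := t * s^-1 => E bt st.
clearbody b u; rewrite /mxdist2 /dist_bound mulr_sumr; apply: ler_sum => a _.
rewrite mulr_sumr; apply: ler_sum => a' _.
set X := v *m v^T *m S in E *; set Y := v *m delta_mx 0 i in E *.
have -> : S a a' - (B *m St) a a' = - (b * X a a' + u * Y a a').
  by rewrite E; clearbody X Y; rewrite !mxE; ring.
rewrite sqrrN -exprMn -real_normK ?num_real // lerXn2r // ?nnegrE.
  by rewrite mulr_ge0 ?addr_ge0 ?mulr_ge0 // ltW.
apply: (le_trans (ler_normD _ _)); rewrite !normrM mulrDr mulrA.
by apply: lerD; rewrite ler_wpM2r // mulrC.
Qed.

End Renormalise.

(** Applied with [A] empty to bound the volume of P by all the pyramids, and with [A] a star to
    bound that star from below. *)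
Lemma generic_cover (R : realType) k m (Q : 'M[R]_(k, m)) f0 (A : set 'cV[R]_k)
    (s : seq {set 'I_m}) : bmx Q f0 \in unitmx -> mble A ->
    (forall J, J \in s -> facet_set Q J) ->
    (forall J, facet_set Q J -> J \in s \/ hull0 Q J `<=` A) ->
  (vol (hull0 Q [set: 'I_m]%SET) <= vol A + \sum_(J <- s) vol (hull0 Q J))%E.
Proof.
move=> uf0 mA sF sA.
have b0 : basis_in Q [set: 'I_m]%SET f0 by split=> // i; rewrite inE.
have mP := mble_hull0 b0.
have [mU leU] : mble (\bigcup_(J in [set` s]) hull0 Q J) /\
    (vol (\bigcup_(J in [set` s]) hull0 Q J) <= \sum_(J <- s) vol (hull0 Q J))%E.
  by apply: vol_bigcup_le => J /sF[_ [f /mble_hull0]].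
have nG := null_nongeneric Q.
rewrite -(vol_diff_null mP nG).
apply: (@le_trans _ _ (vol (A `|` \bigcup_(J in [set` s]) hull0 Q J))).
  apply: vol_le; [exact: mbleD mP (proj1 nG)|exact: mbleU|].
  move=> x [Px /contrapT gx]; have [J [FJ Jx]] := generic_facet uf0 gx Px.
  by have [Js|JA] := sA J FJ; [right; exists J|left; exact: JA].
by apply: (le_trans (volU_le mA mU)); rewrite leeD2l.
Qed.

(** The limit as [t] tends to 0. The factor [1 + t / 2] is what remains of [sqrt (1 + (2 t + t^2) r)
    <= 1 + (t + t^2 / 2) r] after division by [t]. *)
Lemma le_of_small (R : realType) (a b d : R) : 0 <= b -> 0 < d ->
  (forall t, 0 < t -> t < d -> a <= (1 + t / 2) * b) -> a <= b.
Proof.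
move=> b0 d0 H; rewrite leNgt; apply/negP => ab.
have b1 : 0 < 1 + b by lra.
pose t := Num.min (d / 2) ((a - b) / (1 + b)).
have t0 : 0 < t by rewrite lt_min; apply/andP; split; apply: divr_gt0; lra.
have td : t < d by rewrite (@le_lt_trans _ _ (d / 2)) ?ge_min ?lexx //; lra.
have tab : t * (1 + b) <= a - b.
  by rewrite -ler_pdivlMr // ge_min lexx orbT.
have := H t t0 td; nra.
Qed.

Lemma sqnormN (R : realType) k (v : 'cV[R]_k) : sqnorm (- v) = sqnorm v.
Proof. by rewrite /sqnorm dotvN /dotv raddfN /= mulNmx mxE opprK. Qed.

(** * Double counting *)

Section LocalMaximum.
Variables (R : realType) (k n : nat) (S : 'M[R]_(k, n)).
Hypotheses (k0 : (0 < k)%N) (n0 : (0 < n)%N) (SS : S *m S^T = 1%:M).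
Hypothesis hmax : local_max_on_Omega S.
Implicit Types J : {set 'I_(n + n)}.

Let V J : R := fine (vol (hull0 (sym S) J)).
Let VP : R := fine (vol (symhull S)).

Let ex_f0 : exists f, bmx (sym S) f \in unitmx.
Proof. by apply: ex_basis_of; apply: rank_sym; rewrite SS unitmx1. Qed.

Let VE J f : basis_in (sym S) J f -> vol (hull0 (sym S) J) = (V J)%:E /\ 0 < V J.
Proof.
move=> fJ; have lt := vol_hull0_fin fJ; have gt := vol_hull0_gt0 k0 fJ.
have E : vol (hull0 (sym S) J) = (V J)%:E.
  by rewrite fineK // ge0_fin_numE // ltW.
by split=> //; rewrite -lte_fin -E.
Qed.

Let VFE J : facet_set (sym S) J -> vol (hull0 (sym S) J) = (V J)%:E.
Proof. by move=> [_ [f /VE[]]]. Qed.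

Let VF_gt0 J : facet_set (sym S) J -> 0 < V J.
Proof. by move=> [_ [f /VE[]]]. Qed.

Let VPE : vol (symhull S) = VP%:E /\ 0 < VP.
Proof.
have [f uf] := ex_f0; rewrite /VP symhullE //; apply: (@VE _ f).
by split=> // i; rewrite inE.
Qed.

Let sumVE (s : seq {set 'I_(n + n)}) : (forall J, J \in s -> facet_set (sym S) J) ->
  (\sum_(J <- s) vol (hull0 (sym S) J) = (\sum_(J <- s) V J)%:E)%E.
Proof.
move=> sF; rewrite big_seq (eq_bigr (fun J => (V J)%:E)); last by move=> J /sF /VFE.
by rewrite -big_seq sumEFin.
Qed.

Let star_facetsF i J : J \in star_facets S i -> facet_set (sym S) J.
Proof. by rewrite mem_star_facets => /andP[/asboolP]. Qed.

Let sigma i : R := \sum_(J <- star_facets S i) V J.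

Let sigma_le i : sigma i <= sqnorm (col i S) * VP.
Proof.
have [_ [eps [eps0 epsP]]] := hmax; have [vPE VP0] := VPE.
set r := sqnorm _; have r0 : 0 <= r by exact: sqnorm_ge0.
pose C := dist_bound S i.
have C0 : 0 <= C by apply: sumr_ge0 => a _; apply: sumr_ge0 => b _; exact: sqr_ge0.
have C1 : 0 < 1 + C by lra.
(* The distance is at most [t ^+ 2 * C], and [C <= (1 + C) ^+ 2] avoids a square root. *)
pose d := Num.min 1 (eps / (1 + C)).
have d0 : 0 < d by rewrite lt_min ltr01 divr_gt0.
apply: (le_of_small _ d0); first by rewrite mulr_ge0 // ltW.
move=> t t0 td.
have t1 : t <= 1 by rewrite (le_trans (ltW td)) // ge_min lexx.
have te : t * (1 + C) < eps.
  by rewrite -ltr_pdivlMr // (lt_le_trans td) // ge_min lexx orbT.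
have dist : mxdist2 S (gram_inv_sqrt S i t *m stretch S i t) < eps ^+ 2.
  apply: (le_lt_trans (dist_renormalised S i t0 t1)).
  have : (t * (1 + C)) ^+ 2 < eps ^+ 2 by rewrite ltr_pXn2r ?nnegrE // ?mulr_ge0 // ltW.
  apply: le_lt_trans; rewrite exprMn ler_wpM2l ?sqr_ge0 // -/C; nra.
have := epsP _ (uframe_renormalised i SS t0) dist.
have := star_push i SS t0; rewrite (vol_stretch i SS t0) vPE sumVE; last exact: star_facetsF.
set s := gram_norm S i t => le1 le2.
have tt0 : 0 <= (2 * t + t ^+ 2) * r.
  by rewrite mulr_ge0 // addr_ge0 ?sqr_ge0 // mulr_ge0 // ltW.
have s0 : 0 <= s by exact: sqrtr_ge0.
have s2 : s ^+ 2 = 1 + (2 * t + t ^+ 2) * r by rewrite sqr_sqrtr // addr_ge0.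
have s_le : s <= 1 + (t + t ^+ 2 / 2) * r.
  rewrite -(@ler_pXn2r _ 2%N) ?nnegrE //; last by lra.
  by rewrite s2; have := sqr_ge0 ((t + t ^+ 2 / 2) * r); lra.
have : (VP%:E + t%:E * (sigma i)%:E <= s%:E * VP%:E)%E.
  apply: (le_trans le1); apply: lee_wpmul2l; first by rewrite lee_fin.
  by rewrite /Fvol vPE in le2.
rewrite -!EFinM -EFinD lee_fin => H.
have : t * sigma i <= t * ((1 + t / 2) * (r * VP)).
  have : s * VP <= (1 + (t + t ^+ 2 / 2) * r) * VP by rewrite ler_wpM2r // ltW.
  by lra.
by rewrite ler_pM2l.
Qed.

Let isF J := `[< facet_set (sym S) J >].

Let sum_sqnorm : \sum_i sqnorm (col i S) = k%:R.
Proof.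
rewrite -(mxtrace1 R k) -SS /mxtrace; under [RHS]eq_bigr do rewrite mxE.
rewrite exchange_big; apply: eq_bigr => i _; rewrite /sqnorm /dotv mxE.
by apply: eq_bigr => a _; rewrite !mxE.
Qed.

(** A facet contains at most one of [v_i] and [- v_i], so it belongs to exactly |J| of the lists
    [star_facets S i]. *)
Let card_pairs J : facet_set (sym S) J ->
  #|J| = (\sum_(i < n) ((lshift n i \in J) || (rshift n i \in J)))%N.
Proof.
move=> FJ; rewrite -sum1_card big_mkcond big_split_ord /= -big_split /=.
apply: eq_bigr => i _; have := @facet_set_anti _ _ _ S J i FJ.
by case: (lshift n i \in J) => [/(_ isT)/negbTE ->|_] //; case: (_ \in J).
Qed.

Let sigmaE i : sigma i =
  \sum_(J | isF J) V J * ((lshift n i \in J) || (rshift n i \in J))%:R.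
Proof.
rewrite /sigma /star_facets big_filter big_enum_cond /= [RHS]big_mkcond /= big_mkcond /=.
apply: eq_bigr => J _; rewrite /isF.
by case: (asbool _); case: (_ || _); rewrite /= ?mulr1 ?mulr0.
Qed.

Let sum_sigma : \sum_i sigma i = \sum_(J | isF J) V J * #|J|%:R.
Proof.
under eq_bigr do rewrite sigmaE.
rewrite exchange_big; apply: eq_bigr => J /asboolP FJ.
by rewrite -mulr_sumr (card_pairs FJ) natr_sum.
Qed.

Let VP_le_cover (A : set 'cV[R]_k) (s : seq {set 'I_(n + n)}) : mble A ->
    (forall J, J \in s -> facet_set (sym S) J) ->
    (forall J, facet_set (sym S) J -> J \in s \/ hull0 (sym S) J `<=` A) ->
  (VP%:E <= vol A + (\sum_(J <- s) V J)%:E)%E.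
Proof.
move=> mA sF sA; have [f uf] := ex_f0; have [<- _] := VPE.
by rewrite symhullE // -sumVE //; exact: (generic_cover uf).
Qed.

Let VP_le : VP <= \sum_(J | isF J) V J.
Proof.
have [m0 v0] := null_set0 R k.
have := @VP_le_cover set0 [seq J <- enum {set 'I_(n + n)} | isF J] m0.
rewrite v0 add0e lee_fin big_filter big_enum_cond /=; apply.
  by move=> J; rewrite mem_filter => /andP[/asboolP].
by move=> J FJ; left; rewrite mem_filter mem_enum andbT; apply/asboolP.
Qed.

Let sum_cover_le : k%:R * VP <= k%:R * \sum_(J | isF J) V J.
Proof. by rewrite ler_wpM2l // ler0n. Qed.

Let sum_card_le : k%:R * \sum_(J | isF J) V J <= \sum_i sigma i.
Proof.
rewrite sum_sigma mulr_sumr; apply: ler_sum => J /asboolP FJ.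
by rewrite mulrC ler_wpM2l ?(ltW (VF_gt0 FJ)) // ler_nat; exact: (card_facet_set FJ).
Qed.

Let sum_star_le : \sum_i sigma i <= k%:R * VP.
Proof. by rewrite -sum_sqnorm mulr_suml; apply: ler_sum => i _; exact: sigma_le. Qed.

Lemma card_facet J : facet_set (sym S) J -> #|J| = k.
Proof.
move=> FJ.
have D0 : \sum_(J | isF J) V J * (#|J|%:R - k%:R) = 0.
  under eq_bigr do rewrite mulrBr.
  rewrite sumrB -sum_sigma -mulr_suml [_ * k%:R]mulrC; apply/eqP; rewrite subr_eq0 eq_le.
  by rewrite sum_card_le (le_trans sum_star_le sum_cover_le).
have F0 I : isF I -> 0 <= V I * (#|I|%:R - k%:R).
  move=> /asboolP FI; rewrite mulr_ge0 ?(ltW (VF_gt0 FI)) // subr_ge0 ler_nat.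
  exact: (card_facet_set FI).
have : V J * (#|J|%:R - k%:R) = 0 by apply: (psumr_eq0P F0 D0); apply/asboolP.
move=> /eqP; rewrite mulf_eq0 (gt_eqF (VF_gt0 FJ)) /= subr_eq0 eqr_nat.
by move=> /eqP.
Qed.

Let VP_sum : VP = \sum_(J | isF J) V J.
Proof.
apply/eqP; rewrite eq_le VP_le /= -(ler_pM2l (_ : 0 < k%:R)) ?ltr0n //.
exact: le_trans sum_card_le sum_star_le.
Qed.

Let sigma_eq i : sigma i = sqnorm (col i S) * VP.
Proof.
have D0 : \sum_j (sqnorm (col j S) * VP - sigma j) = 0.
  rewrite sumrB -mulr_suml sum_sqnorm; apply/eqP; rewrite subr_eq0 eq_le sum_star_le andbT.
  exact: le_trans sum_cover_le sum_card_le.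
have F0 j : true -> 0 <= sqnorm (col j S) * VP - sigma j by rewrite subr_ge0 sigma_le.
have : sqnorm (col i S) * VP - sigma i = 0 by exact: (psumr_eq0P F0 D0).
by move=> /eqP; rewrite subr_eq0 => /eqP.
Qed.

Lemma vol_star i : sqnorm (col i S) =
  fine (vol (star (symhull S) (col i S))) / fine (vol (symhull S)).
Proof.
have [_ VP0] := VPE; rewrite star_symhull // -/VP.
have [mU leU] : mble (\bigcup_(J in [set` star_facets S i]) hull0 (sym S) J) /\
    (vol (\bigcup_(J in [set` star_facets S i]) hull0 (sym S) J) <=
      \sum_(J <- star_facets S i) vol (hull0 (sym S) J))%E.
  by apply: vol_bigcup_le => J /star_facetsF[_ [f /mble_hull0]].
set U := \bigcup_(J in _) _ in mU leU *.
rewrite sumVE in leU; last exact: star_facetsF.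
have UE : vol U = (fine (vol U))%:E.
  by rewrite fineK // ge0_fin_numE ?vol_ge0 // (le_lt_trans leU) // ltry.
(* Subadditivity gives the upper bound [sigma i] for the star. For the lower one, the star and the
   remaining pyramids, of total volume [VP - sigma i], cover P up to a null set. *)
have geU : (VP%:E <= vol U + (VP - sigma i)%:E)%E.
  have -> : VP - sigma i = \sum_(J <- [seq J <- enum {set 'I_(n + n)} | isF J &&
      ~~ ((lshift n i \in J) || (rshift n i \in J))]) V J.
    rewrite VP_sum (bigID (fun J => (lshift n i \in J) || (rshift n i \in J))) /=.
    rewrite /sigma /star_facets !big_filter !big_enum_cond /=.
    by rewrite addrAC subrr add0r.
  apply: VP_le_cover => // J.
    by rewrite mem_filter => /andP[/andP[/asboolP]].
  move=> FJ; rewrite mem_filter mem_enum andbT /isF asboolT //=.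
  have [iJ|_] := boolP (_ || _); [right|by left].
  by move=> x Jx; exists J => //=; rewrite mem_star_facets asboolT.
rewrite UE lee_fin in leU; rewrite UE -EFinD lee_fin in geU.
have -> : fine (vol U) = sigma i by apply/eqP; rewrite eq_le leU /=; lra.
by rewrite sigma_eq mulfK // gt_eqF.
Qed.

End LocalMaximum.

Unset Implicit Arguments.

Theorem theorem3 (R : realType) (n k : nat) (hk : (2 <= k)%N) (hkn : (k <= n)%N)
    (S : 'M[R]_(k, n)) (hS : uframe S) (hmax : local_max_on_Omega S) :
  simplicial (symhull S) /\
  forall v : 'cV[R]_k, vertex (symhull S) v ->
    sqnorm v = fine (vol (star (symhull S) v)) / fine (vol (symhull S)).
Proof.
have k0 : (0 < k)%N by exact: ltnW.
have n0 : (0 < n)%N by exact: leq_trans hkn.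
have [_ SS] := hS; split.
  move=> F /(facet_symhull n0 SS)[J [FJ ->]].
  exact: face_simplex FJ (card_facet k0 n0 SS hmax FJ).
move=> v /vertex_symhull[i [->|->]]; first exact: vol_star.
have -> : star (symhull S) (- col i S) = star (symhull S) (col i S).
  apply/seteqP; split => x [F [FF [vF Fx]]]; exists F; split=> //; split=> //;
  by move: vF; rewrite ?opprK => -[]; [right|left].
by rewrite sqnormN; exact: vol_star.
Qed.
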